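(* Let $R$ be a countable principal ideal domain which has only finitely many, but at least two, primes (up to associates). If there is an $R$-module of cardinality $\aleph_1$ which is hereditarily separable and not free, then there is a Whitehead $R$-module of cardinality $\aleph_1$ which is not free.
   Context: An $R$-module $M$ (torsion-free) is separable if every finite rank pure submodule of $M$ is a free direct summand of $M$; $M$ is hereditarily separable if every submodule of $M$ is separable. An $R$-module $M$ is a Whitehead module if $\mathrm{Ext}_R(M,R)=0$. *)

(* Defs.v *)
From HB Require Import structures.
From mathcomp Require Import all_boot all_order all_algebra.
From mathcomp Require Import boolp classical_sets cardinality wochoice.

Set Implicit Arguments.
Unset Strict Implicit.
Unset Printing Implicit Defensive.

Import GRing.Theory.
Local Open Scope ring_scope.

Section Rings.
Variable R : idomainType.

(* The ideals of R are the submodules of the regular module R^o.              *)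
Definition is_PID : Prop :=
  forall I : submodClosed R^o,
    exists a : R, forall x : R, x \in I <-> exists b : R, x = b * a.

Definition divides (a b : R) : Prop := exists c : R, b = c * a.

Definition prime_element (p : R) : Prop :=
  [/\ p != 0, p \isn't a GRing.unit &
      forall a b : R, divides p (a * b) -> divides p a \/ divides p b].

Definition associates (a b : R) : Prop :=
  exists2 u : R, u \is a GRing.unit & b = u * a.

Definition finitely_many_primes : Prop :=
  exists s : seq R, forall p : R, prime_element p ->
    exists2 q : R, q \in s & associates q p.

Definition at_least_two_primes : Prop :=
  exists p q : R, [/\ prime_element p, prime_element q & ~ associates p q].

End Rings.

(* T is equinumerous with omega_1, the first uncountable ordinal: omega_1 is, *)
(* up to isomorphism, the only uncountable well-order all of whose initial    *)
(* segments are countable.                                                    *)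
Definition has_card_aleph1 (T : Type) : Prop :=
  ~ countable [set: T]%classic /\
  exists le : rel T,
    well_order le /\ forall x : T, countable [set y | le y x]%classic.

Section Submodule.
Variables (R : idomainType) (M : lmodType R) (S : submodClosed M).

Record submod := Submod { submod_val : M; _ : submod_val \in S }.

HB.instance Definition _ := [isSub for submod_val].
HB.instance Definition _ := [Choice of submod by <:].
HB.instance Definition _ := [SubChoice_isSubLmodule of submod by <:].

End Submodule.

Section Modules.
Variable R : idomainType.
Implicit Types M N : lmodType R.

Definition lin_indep M (B : {pred M}) : Prop :=
  forall (s : seq M) (c : M -> R), uniq s -> {subset s <= B} ->
    \sum_(x <- s) c x *: x = 0 -> forall x, x \in s -> c x = 0.

Definition spanning M (B : {pred M}) : Prop :=
  forall y : M, exists (s : seq M) (c : M -> R),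
    {subset s <= B} /\ y = \sum_(x <- s) c x *: x.

Definition is_free M : Prop :=
  exists B : {pred M}, lin_indep B /\ spanning B.

Definition torsion_free M : Prop :=
  forall (r : R) (x : M), r *: x = 0 -> r = 0 \/ x = 0.

(* The rank is the supremum of the sizes of the finite independent subsets.   *)
Definition finite_rank M : Prop :=
  exists n : nat, forall s : seq M,
    uniq s -> lin_indep [in s] -> (size s <= n)%N.

(* S :&: r M = r S for all r : R.                                             *)
Definition pure M (S : submodClosed M) : Prop :=
  forall (r : R) (x : M), r *: x \in S -> exists2 y, y \in S & r *: x = r *: y.

Definition direct_summand M (S : submodClosed M) : Prop :=
  exists T : submodClosed M,
    (forall x : M, exists y z : M, [/\ y \in S, z \in T & x = y + z]) /\
    (forall x : M, x \in S -> x \in T -> x = 0).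

Definition separable M : Prop :=
  torsion_free M /\
  forall S : submodClosed M, finite_rank (submod S) -> pure S ->
    is_free (submod S) /\ direct_summand S.

Definition hereditarily_separable M : Prop :=
  forall S : submodClosed M, separable (submod S).

End Modules.

(* Ext_R(M, N) as the Yoneda Ext: the equivalence classes of short exact      *)
(* sequences 0 -> N -> E -> M -> 0, whose zero is the class of N (+) M.       *)
Section Ext.
Variables (R : idomainType) (M N : lmodType R).

Record extension := Extension {
  ext_mod : lmodType R;
  ext_inj : {linear N -> ext_mod};
  ext_proj : {linear ext_mod -> M};
  ext_injective : injective ext_inj;
  ext_surjective : forall m : M, exists e, ext_proj e = m;
  ext_exact : forall e, ext_proj e = 0 <-> exists n : N, ext_inj n = e }.

(* By the five lemma h is automatically an isomorphism.                       *)
Definition ext_equiv (E E' : extension) : Prop :=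
  exists h : {linear ext_mod E -> ext_mod E'},
    (forall n : N, h (ext_inj E n) = ext_inj E' n) /\
    (forall e, ext_proj E' (h e) = ext_proj E e).

Definition split_inj (n : N) : (N * M)%type := (n, 0).

Fact split_inj_is_linear : linear split_inj.
Proof. by move=> a x y; apply/eqP; rewrite xpair_eqE /= scaler0 addr0 !eqxx. Qed.

HB.instance Definition _ :=
  GRing.isLinear.Build R N (N * M)%type *:%R split_inj split_inj_is_linear.

Fact split_inj_injective : injective split_inj.
Proof. by move=> x y []. Qed.

Fact split_proj_surjective (m : M) : exists e : N * M, e.2 = m.
Proof. by exists (0, m). Qed.

Fact split_exact (e : N * M) : e.2 = 0 <-> exists n : N, split_inj n = e.
Proof.
by case: e => n m; split=> [/= -> | [n' [_ <-]] //]; exists n.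
Qed.

Definition split_extension : extension :=
  @Extension (N * M)%type split_inj (@snd N M)
    split_inj_injective split_proj_surjective split_exact.

Definition Ext_eq0 : Prop := forall E : extension, ext_equiv E split_extension.

End Ext.

Definition whitehead (R : idomainType) (M : lmodType R) : Prop :=
  Ext_eq0 M R^o.

(* Main.v *)
Require Import Defs.
From HB Require Import structures.
From mathcomp Require Import all_boot all_order all_algebra.
From mathcomp Require Import boolp classical_sets functions cardinality wochoice.
From mathcomp Require Import ring.

(** Write [R_p] for the localization of [R] at [p] and [K] for its fraction field, and fix a
hereditarily separable, non-free [M] of cardinality aleph_1 filtered by initial segments [I_b] of
a well-order. Since [M] is not free, for many [b] some [x] is divisible by all powers of a prime [p]
modulo [I_b] and finitely many further elements [xs]: [p ^ n z_n = x + sum_j u_(n,j) xs_j - s_n]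
with [s_n] in [I_b]. Taking [xs] as short as possible makes these data rigid. The sequence of the
[(s_n, u_n)] is a branch, indexed by [b], of a tree of height omega; [N] is the module generated by
the nodes of this tree and, along each branch, a chain [y_n = node_(n+1) + p y_(n+1)]. A closing-off
argument shows that if [N] were free for all [p], so would be [M].

That [N] is a Whitehead module amounts to a uniformization property: given p-adic integers [C_b],
some function on the nodes predicts [C_b] modulo [p ^ n] from the [n]-th node of the branch of [b],
for all large [n]. Choose [phi : M -> K / R_p] sending [x] to [0] in such a way that it
encodes [C_b] on the [z_n]. Hereditary separability, applied to the kernel of [phi],
lifts to [K] not [phi] itself but its composite with some automorphism of its image; since that
automorphism is the same for all [b], the lift [g] still determines [C_b] once the values
[g x], [g xs_j] are known. These values range over a countable set, and they are guessed using
a second prime [q]: in the same way some [g' : M -> K] with values in [R[1/q]] encodes them in the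
polar part at [q] of [g' x]; as [R[1/q]] is countable and contained in [R_p], comparing with the
data on the branch modulo powers of [p] eventually singles out [g' x] and the [g' xs_j]. *)

Set Implicit Arguments.
Unset Strict Implicit.
Unset Printing Implicit Defensive.

Import GRing.Theory.
Local Open Scope classical_set_scope.
Local Open Scope ring_scope.

(** * Submodules as sets, and their conversion to bundled submodules *)

Section SubmoduleOfSet.
Variables (R : idomainType) (M : lmodType R).

Definition submodule (S : set M) : Prop :=
  S 0 /\ forall r x y, S x -> S y -> S (r *: x + y).

Section Closure.
Variables (S : set M) (subS : submodule S).

Lemma submoduleD x y : S x -> S y -> S (x + y).
Proof. by move=> Sx Sy; rewrite -[x]scale1r; apply: subS.2. Qed.

Lemma submoduleZ r x : S x -> S (r *: x).
Proof. by move=> Sx; rewrite -[_ *: x]addr0; apply: subS.2 => //; exact: subS.1. Qed.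

Lemma submoduleN x : S x -> S (- x).
Proof. by move=> Sx; rewrite -scaleN1r; apply: submoduleZ. Qed.

Lemma submoduleB x y : S x -> S y -> S (x - y).
Proof. by move=> Sx Sy; apply: submoduleD => //; apply: submoduleN. Qed.

Lemma submodule_sum (I : eqType) (l : seq I) (F : I -> M) :
  (forall i, i \in l -> S (F i)) -> S (\sum_(i <- l) F i).
Proof.
move=> SF; rewrite big_seq; elim/big_ind: _ => [|x y|i]; [exact: subS.1 | |exact: SF].
exact: submoduleD.
Qed.

Definition set_pred of submodule S : {pred M} := fun x => `[< S x >].

Fact set_pred_closed : subsemimod_closed (set_pred subS).
Proof.
split; first split.
- by apply/asboolP; exact: subS.1.
- by move=> x y /asboolP Sx /asboolP Sy; apply/asboolP/submoduleD.
by move=> r x /asboolP Sx; apply/asboolP/submoduleZ.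
Qed.

HB.instance Definition _ := 
  GRing.isSubmodClosed.Build R M (set_pred subS) set_pred_closed.

Lemma submodClosed_of_set : exists T : submodClosed M, forall x, (x \in T) = `[< S x >].
Proof. by exists (GRing.SubmodClosed.clone R M (set_pred subS) _). Qed.

End Closure.

Lemma submodule_of_submodClosed (T : submodClosed M) : submodule [set x | x \in T].
Proof. by split=> [|r x y /= xT yT]; rewrite /= ?rpred0 // rpredD // rpredZ. Qed.

End SubmoduleOfSet.

(** * Principal ideal domains *)

Section PID.
Variables (R : idomainType) (R_PID : is_PID R).
Implicit Types (a b p r s : R).

Lemma ideal_principal (I : set R) : I 0 -> (forall r x y, I x -> I y -> I (r * x + y)) ->
  exists2 d, I d & forall x, I x -> divides d x.
Proof.
move=> I0 Il; have [|T TI] := @submodClosed_of_set R R^o I; first by split.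
have [d dP] := R_PID T; exists d.
  by apply/asboolP; rewrite -TI; apply/dP; exists 1; rewrite mul1r.
by move=> x Ix; have /dP[b ->] : (x : R^o) \in T by [rewrite TI; apply/asboolP]; exists b.
Qed.

Lemma divides_refl r : divides r r.
Proof. by exists 1; rewrite mul1r. Qed.

Lemma divides_trans s r a : divides r s -> divides s a -> divides r a.
Proof. by move=> [u ->] [v ->]; exists (v * u); rewrite mulrA. Qed.

Lemma dividesD r a b : divides r a -> divides r b -> divides r (a + b).
Proof. by move=> [u ->] [v ->]; exists (u + v); rewrite mulrDl. Qed.

Lemma dividesMl r a b : divides r b -> divides r (a * b).
Proof. by move=> [u ->]; exists (a * u); rewrite mulrA. Qed.

Lemma dividesMr r a b : divides r a -> divides r (a * b).
Proof. by rewrite mulrC; apply: dividesMl. Qed.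

Lemma dividesN r a : divides r a -> divides r (- a).
Proof. by move=> [u ->]; exists (- u); rewrite mulNr. Qed.

Lemma divides_mul2l s r a : s != 0 -> divides (s * r) (s * a) -> divides r a.
Proof.
by move=> s0 [c]; rewrite mulrCA => /(mulfI s0) ->; exists c.
Qed.

Lemma divides0 r : divides r 0.
Proof. by exists 0; rewrite mul0r. Qed.

Lemma divides_exp p m n : (m <= n)%N -> divides (p ^+ m) (p ^+ n).
Proof. by move=> /subnK <-; exists (p ^+ (n - m)); rewrite exprD. Qed.

Lemma divides_unit r a : divides r a -> a \is a GRing.unit -> r \is a GRing.unit.
Proof. by move=> [u ->]; rewrite unitrM => /andP[]. Qed.

Lemma bezout a b : exists d, [/\ divides d a, divides d b & exists u v, d = u * a + v * b].
Proof.
have [||d [u [v dE]] dP] := @ideal_principal [set x | exists u v, x = u * a + v * b].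
- by exists 0, 0; rewrite !mul0r addr0.
- move=> r _ _ [u [v ->]] [u' [v' ->]]; exists (r * u + u'), (r * v + v').
  by ring.
exists d; split; last by exists u, v.
  by apply: dP; exists 1, 0; rewrite mul1r mul0r addr0.
by apply: dP; exists 0, 1; rewrite mul1r mul0r add0r.
Qed.

(** The ideals generated by the [r n] increase. Their union is principal, and its generator already
    lies in one of them, where the chain stops. *)
Lemma divides_chain (r : nat -> R) : (forall n, divides (r n.+1) (r n)) ->
  exists n, divides (r n) (r n.+1).
Proof.
move=> rS; have rle m n : (m <= n)%N -> divides (r n) (r m).
  move=> /subnKC <-; elim: (n - m)%N => [|k IH]; first by rewrite addn0; apply: divides_refl.
  by rewrite addnS; apply: divides_trans (rS _) IH.
have [||d [n dn] dP] := @ideal_principal [set x | exists n, divides (r n) x].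
- by exists 0%N; apply: divides0.
- move=> s x y [m mx] [n ny]; exists (maxn m n); apply: dividesD.
    by apply/dividesMl/divides_trans/mx/rle/leq_maxl.
  by apply/divides_trans/ny/rle/leq_maxr.
exists n; apply: (divides_trans dn); apply: dP; exists n.+1; exact: divides_refl.
Qed.

(** If [a] were nonzero, its quotients by the [p ^+ n] would generate a strictly increasing chain of
    ideals. *)
Lemma divides_pow_eq0 p a : p \isn't a GRing.unit ->
  (forall n, divides (p ^+ n) a) -> a = 0.
Proof.
move=> pU pa; apply: contrapT => /eqP a0.
have p0 : p != 0.
  by apply: contra_neq a0 => p0; have [c ->] := pa 1%N; rewrite p0 expr1 mulr0.
have /choice[c cE] := pa.
have cS n : c n = p * c n.+1.
  by apply: (mulIf (expf_neq0 n p0)); rewrite -cE {1}(cE n.+1) exprS mulrCA mulrA.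
have [|n [d cn]] := @divides_chain c; first by move=> n; exists p; apply: cS.
have cn0 : c n.+1 != 0.
  by apply: contra_neq a0 => cn0; rewrite (cE n.+1) cn0 mul0r.
have : 1 = d * p.
  by apply: (mulIf cn0); rewrite -mulrA -cS mul1r -cn.
by move=> /esym dp; move: pU; apply/negP/negPn/(@divides_unit _ 1); [exists d | exact: unitr1].
Qed.

Lemma prime_exact p a : prime_element p -> a != 0 ->
  exists n, exists2 b, a = b * p ^+ n & ~ divides p b.
Proof.
move=> [p0 pU _] a0.
have [n np] : exists n, ~ divides (p ^+ n) a.
  apply: contrapT => /forallNP np; case/negP: a0; apply/eqP/(divides_pow_eq0 pU) => n.
  by apply: contrapT; exact: np.
elim: n np => [np|n IH np].
  by case: np; exists a; rewrite expr0 mulr1.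
have [[b ab]|/IH//] := EM (divides (p ^+ n) a).
exists n, b => // -[c bc]; apply: np; exists c.
by rewrite ab bc exprS mulrA.
Qed.

Lemma prime_coprime p a : prime_element p -> ~ divides p a -> exists u v, u * p + v * a = 1.
Proof.
move=> [p0 pU pP] npa; have [d [[c pcd] da [u [v dE]]]] := bezout p a.
have [|[e ce]|[e de]] := pP c d; first by rewrite -pcd; apply: divides_refl.
  have dU : d \is a GRing.unit.
    apply: (@divides_unit _ 1); last exact: unitr1.
    by exists e; apply: (mulIf p0); rewrite mul1r {1}pcd ce mulrAC.
  exists (d^-1 * u), (d^-1 * v).
  by rewrite -!mulrA -mulrDr -dE mulVr.
by case: npa; apply: divides_trans da; exists e.
Qed.

Lemma prime_not_divides_mul p a b : prime_element p ->
  ~ divides p a -> ~ divides p b -> ~ divides p (a * b).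
Proof. by move=> [_ _ pP] pa pb /pP[]. Qed.

Lemma prime_not_divides_exp p q n : prime_element p -> ~ divides p q -> ~ divides p (q ^+ n).
Proof.
move=> pp pq; elim: n => [|n IH]; last by rewrite exprS; apply: prime_not_divides_mul.
case: pp => _ pU _; rewrite expr0 => /divides_unit/(_ (unitr1 _)).
exact/negP.
Qed.

Lemma prime_exp_divides p n a b : prime_element p -> ~ divides p b ->
  divides (p ^+ n) (a * b) -> divides (p ^+ n) a.
Proof.
move=> pp pb; elim: n a => [|n IH] a.
  by move=> _; rewrite expr0; exists a; rewrite mulr1.
have [p0 pU pP] := pp; move=> pn.
have /pP[[c ac]|//] : divides p (a * b).
  by apply: divides_trans pn; exists (p ^+ n); rewrite exprSr.
rewrite ac exprS [c * p]mulrC; have [|d ->] := IH c.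
  apply: (divides_mul2l p0); rewrite -exprS.
  by have -> : p * (c * b) = a * b by rewrite ac; ring.
by exists d; ring.
Qed.

Lemma prime_divides_associates p q : prime_element p -> prime_element q ->
  divides p q -> associates p q.
Proof.
move=> [p0 pU pP] [q0 qU qP] [c qc].
have [|[e ce]|[e pe]] := qP c p; first by rewrite -qc; apply: divides_refl.
  case/negP: pU; apply: (@divides_unit _ 1); last exact: unitr1.
  by exists e; apply: (mulIf q0); rewrite mul1r {1}qc ce mulrAC.
exists c => //; apply: (@divides_unit _ 1); last exact: unitr1.
by exists e; apply: (mulIf p0); rewrite mul1r {1}pe qc mulrA.
Qed.

Lemma irreducible_prime a : a != 0 -> a \isn't a GRing.unit ->
  (forall b, divides b a -> b \isn't a GRing.unit -> divides a b) -> prime_element a.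
Proof.
move=> a0 aU aI; split=> // x y axy; have [d [da dx [u [v dE]]]] := bezout a x.
have [dU|dU] := boolP (d \is a GRing.unit); last by left; apply: divides_trans dx; exact: aI.
right; have -> : y = d^-1 * (u * y * a + v * (x * y)).
  apply: (mulrI dU); rewrite mulVKr // dE; ring.
by apply/dividesMl/dividesD; [exact/dividesMl/divides_refl | exact/dividesMl].
Qed.

(** A counterexample has a proper divisor that is again one, since otherwise it would be
    irreducible, hence prime. Iterating contradicts [divides_chain]. *)
Lemma prime_divisor r : r != 0 -> r \isn't a GRing.unit ->
  exists2 p, prime_element p & divides p r.
Proof.
pose bad a := [/\ a != 0, a \isn't a GRing.unit & forall p, prime_element p -> ~ divides p a].
move=> r0 rU; apply: contrapT => rP.
have badr : bad r by split=> // p pp pr; apply: rP; exists p.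
have /choice[f fP] a : exists b, bad a -> [/\ bad b, divides b a & ~ divides a b].
  have [[a0 aU aP]|//] := EM (bad a); last by exists 0.
  apply: contrapT => nb; case: (aP a); last exact: divides_refl.
  apply: irreducible_prime => // b ba bU; apply: contrapT => nab.
  apply: nb; exists b => _; split=> //; split=> //.
    by apply: contra_neq a0 => b0; have [c ->] := ba; rewrite b0 mulr0.
  by move=> p pp pb; apply: (aP p pp); apply: divides_trans pb ba.
have badn n : bad (iter n f r) by elim: n => // n /fP[].
have [n|n] := @divides_chain (fun n => iter n f r); first by have [] := fP _ (badn n).
by have [] := fP _ (badn n).
Qed.

End PID.

(** * Linear forms on separable modules *)

Section Functionals.
Variables (R : idomainType).
Implicit Types M : lmodType R.

Lemma sum_undup_scale M (s : seq M) (c : M -> R) :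
  \sum_(x <- s) c x *: x = \sum_(x <- undup s) ((count_mem x s)%:R * c x) *: x.
Proof.
rewrite -[LHS]big_undup_iterop_count; apply: eq_bigr => x _.
by rewrite -scalerA scaler_nat.
Qed.

Lemma sum_sub (I : eqType) M (s t : seq I) (F : I -> M) : uniq s -> uniq t ->
  {subset s <= t} -> (forall x, x \notin s -> F x = 0) -> \sum_(x <- t) F x = \sum_(x <- s) F x.
Proof.
move=> us ut st F0; rewrite (bigID [in s]) /= [X in _ + X]big1 ?addr0 //.
rewrite -big_filter; apply/perm_big/uniq_perm => //; first exact: filter_uniq.
by move=> x; rewrite mem_filter; case: (boolP (x \in s)) => //= /st.
Qed.

Lemma sum_supp M (s t : seq M) (c : M -> R) : uniq s -> uniq t -> {subset s <= t} ->
  (forall x, x \notin s -> c x = 0) ->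
  \sum_(x <- t) c x *: x = \sum_(x <- s) c x *: x.
Proof. by move=> us ut st c0; apply: sum_sub => // x /c0 ->; rewrite scale0r. Qed.

(** Coordinates are indexed by all elements of [M], so that later arguments need not mention the
    basis. Linearity comes from independence, applied to the union of three supports. *)
Lemma free_coord M : is_free M -> exists co : M -> M -> R,
  (forall b r x y, co (r *: x + y) b = r * co x b + co y b) /\
  (forall x, exists s : seq M, [/\ uniq s, forall b, b \notin s -> co x b = 0
     & x = \sum_(b <- s) co x b *: b]).
Proof.
move=> [B [Bind Bspan]].
have /choice[rep repP] x : exists rc : seq M * (M -> R), [/\ uniq rc.1, {subset rc.1 <= B},
    forall b, b \notin rc.1 -> rc.2 b = 0 & x = \sum_(b <- rc.1) rc.2 b *: b].
  have [s [c [sB xE]]] := Bspan x.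
  exists (undup s, fun b => if b \in s then (count_mem b s)%:R * c b else 0); split => /=.
  - exact: undup_uniq.
  - by move=> b; rewrite mem_undup; apply: sB.
  - by move=> b; rewrite mem_undup => /negbTE ->.
  rewrite xE sum_undup_scale [LHS]big_seq [RHS]big_seq; apply: eq_bigr => b.
  by rewrite mem_undup => ->.
exists (fun x => (rep x).2); split; last first.
  by move=> x; have [us _ c0 xE] := repP x; exists (rep x).1.
move=> b r x y; pose z := r *: x + y.
pose t := undup ((rep x).1 ++ (rep y).1 ++ (rep z).1).
have ut : uniq t by exact: undup_uniq.
have [ux xB cx xE] := repP x; have [uy yB cy yE] := repP y; have [uz zB cz zE] := repP z.
have sx : {subset (rep x).1 <= t} by move=> a ax; rewrite mem_undup !mem_cat ax.
have sy : {subset (rep y).1 <= t} by move=> a ay; rewrite mem_undup !mem_cat ay orbT.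
have sz : {subset (rep z).1 <= t} by move=> a az; rewrite mem_undup !mem_cat az !orbT.
have tB : {subset t <= B}.
  by move=> a; rewrite mem_undup !mem_cat => /or3P[/xB|/yB|/zB].
have [bt|bt] := boolP (b \in t); last first.
  rewrite cx ?cy ?cz ?mulr0 ?addr0 //; by apply: contra bt; first [exact: sx | exact: sy | exact: sz].
apply/eqP; rewrite -subr_eq0; apply/eqP.
apply: (Bind t (fun b => (rep z).2 b - (r * (rep x).2 b + (rep y).2 b))) => //.
under eq_bigr do rewrite scalerBl scalerDl -scalerA.
rewrite sumrB big_split /= -scaler_sumr.
by rewrite (sum_supp uz ut sz cz) (sum_supp ux ut sx cx) (sum_supp uy ut sy cy) -xE -yE -zE subrr.
Qed.

Lemma free_functional M (p : R) x : is_free M -> (forall y, x <> p *: y) ->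
  exists chi : M -> R, (forall r x y, chi (r *: x + y) = r * chi x + chi y) /\
    ~ divides p (chi x).
Proof.
move=> /free_coord[co [coL coE]] xp; apply: contrapT => nchi.
have /choice[d dE] b : divides p (co x b).
  by apply: contrapT => nd; apply: nchi; exists (co^~ b).
have [s [_ _ xE]] := coE x; apply: (xp (\sum_(b <- s) d b *: b)).
by rewrite [LHS]xE scaler_sumr; apply: eq_bigr => b _; rewrite scalerA mulrC -dE.
Qed.

Lemma direct_summand_proj M (S : submodClosed M) : direct_summand S ->
  exists pr : M -> submod S, (forall r x y, pr (r *: x + y) = r *: pr x + pr y) /\
    forall x : submod S, pr (val x) = x.
Proof.
move=> [T [dec ST0]].
have /choice[pr prP] x : exists y : submod S, x - val y \in T.
  have [y [z [yS zT ->]]] := dec x.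
  by exists (Sub y yS); rewrite SubK addrC addKr.
have uniq_pr x (y y' : submod S) : x - val y \in T -> x - val y' \in T -> y = y'.
  move=> yT y'T; apply/val_inj/eqP; rewrite -subr_eq0; apply/eqP/ST0.
    by apply: (submoduleB (submodule_of_submodClosed S)); apply: valP.
  have := submoduleB (submodule_of_submodClosed T) y'T yT.
  by rewrite /= opprB addrC addrA subrK.
exists pr; split => [r x y|x]; last first.
  by apply: uniq_pr (prP _) _; rewrite subrr rpred0.
apply: uniq_pr (prP _) _.
have -> : r *: x + y - val (r *: pr x + pr y) = r *: (x - val (pr x)) + (y - val (pr y)).
  by rewrite GRing.valD GRing.valZ scalerBr opprD addrACA.
by rewrite rpredD // rpredZ.
Qed.

(** The pure closure of [x] has rank one, hence is a free direct summand. A coordinate on it that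
    [p] does not divide at [x] is carried to [M] by the projection. *)
Lemma separable_functional M (p : R) x : separable M -> (forall y, x <> p *: y) ->
  exists chi : M -> R, (forall r x y, chi (r *: x + y) = r * chi x + chi y) /\
    ~ divides p (chi x).
Proof.
move=> [tf sepM] xp.
have x0 : x <> 0 by move=> x0; apply: (xp 0); rewrite scaler0.
pose L := [set y : M | exists r s : R, r != 0 /\ r *: y = s *: x].
have subL : submodule L.
  split; first by exists 1, 0; rewrite oner_eq0 !scale0r scaler0.
  move=> r y z [a [b [a0 ay]]] [c [d [c0 cz]]]; exists (a * c), (r * c * b + a * d).
  rewrite mulf_neq0 //; split=> //; rewrite scalerDr scalerDl -!scalerA -ay -cz !scalerA.
  by congr (_ *: _ + _ *: _); ring.
have [T TL] := submodClosed_of_set subL.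
have [||Tfree Tsum] := sepM T.
- exists 1%N => -[|y1 [|y2 s]] //= /andP[]; rewrite inE negb_or => /andP[y12 _] _ ind.
  have [r1 [s1 [r10 E1]]] : L (val y1) by apply/asboolP; rewrite -TL; apply: valP.
  have [r2 [s2 [r20 E2]]] : L (val y2) by apply/asboolP; rewrite -TL; apply: valP.
  have tf0 r (y : submod T) : r *: y = 0 -> r = 0 \/ y = 0.
    move=> /(congr1 val); rewrite GRing.valZ linear0 => /tf[]; first by left.
    by move=> y0; right; apply: val_inj; rewrite y0 linear0.
  have ind2 c1 c2 : c1 *: y1 + c2 *: y2 = 0 -> c1 = 0 /\ c2 = 0.
    move=> E; pose c y := if y == y1 then c1 else c2.
    have cI : forall y, y \in [:: y1; y2] -> c y = 0.
      apply: ind; first by rewrite /= inE y12.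
        by move=> y; rewrite !inE => /orP[->|/eqP ->] //; rewrite eqxx orbT.
      by rewrite big_cons big_seq1 /c eqxx eq_sym (negbTE y12).
    split; first by have := cI y1; rewrite /c eqxx inE eqxx; apply.
    by have := cI y2; rewrite /c eq_sym (negbTE y12) !inE eqxx orbT; apply.
  (* Both [s2 * r1 *: y1] and [s1 * r2 *: y2] equal [s1 * s2 *: x], so any two elements of [L] are
     dependent. *)
  have [s2r1 _] : s2 * r1 = 0 /\ - (s1 * r2) = 0.
    apply: ind2; apply: val_inj; rewrite GRing.valD !GRing.valZ linear0 scaleNr -!scalerA.
    by rewrite E1 E2 !scalerA mulrC subrr.
  have s20 : s2 = 0 by apply/eqP; move/eqP: s2r1; rewrite mulf_eq0 (negbTE r10) orbF.
  have [_ r2_0] : 0 = 0 :> R /\ r2 = 0.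
    by apply: ind2; apply: val_inj; rewrite scale0r add0r GRing.valZ E2 s20 scale0r linear0.
  by rewrite r2_0 eqxx in r20.
- move=> r y ryT; have [->|r0] := eqVneq r 0; first by exists 0; rewrite ?rpred0 ?scale0r ?scaler0.
  exists y => //; have [a [b [a0 E]]] : L (r *: y) by apply/asboolP; rewrite -TL.
  by rewrite TL; apply/asboolP; exists (a * r), b; rewrite mulf_neq0 // -scalerA.
have xT : x \in T by rewrite TL; apply/asboolP; exists 1, 1; rewrite oner_eq0.
have [|chi [chiL chix]] := @free_functional (submod T) p (Sub x xT) Tfree.
  by move=> y /(congr1 val); rewrite SubK GRing.valZ; apply: xp.
have [pr [prL prE]] := direct_summand_proj Tsum.
exists (chi \o pr); split => [r y z /=|/=]; first by rewrite prL chiL.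
suff -> : pr x = Sub x xT by [].
by have := prE (Sub x xT); rewrite SubK.
Qed.

(** The form is a total function that is linear on [S] only; [insubd 0] collapses everything outside
    [S]. *)
Lemma hersep_functional M (p : R) (S : set M) x : hereditarily_separable M -> submodule S ->
  S x -> (forall y, S y -> x <> p *: y) ->
  exists chi : M -> R,
    (forall r x y, S x -> S y -> chi (r *: x + y) = r * chi x + chi y) /\ ~ divides p (chi x).
Proof.
move=> hs subS Sx xp; have [T TS] := submodClosed_of_set subS.
have inT y : S y -> y \in T by rewrite TS => Sy; apply/asboolP.
have [|chi [chiL chix]] := @separable_functional (submod T) p (Sub x (inT x Sx)) (hs T).
  move=> y /(congr1 val); rewrite SubK GRing.valZ; apply: xp.
  by apply/asboolP; rewrite -TS; apply: valP.
have E y (Sy : S y) : insubd (0 : submod T) y = Sub y (inT y Sy).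
  by apply: val_inj; rewrite insubdK ?SubK //; exact: (inT y Sy).
exists (chi \o insubd 0); split=> [r y z Sy Sz /=|/=]; last by rewrite (E x Sx).
have Sryz := subS.2 r _ _ Sy Sz.
rewrite (E _ Sy) (E _ Sz) (E _ Sryz) -chiL; congr chi.
by apply: val_inj; rewrite GRing.valD GRing.valZ !SubK.
Qed.

Lemma hersep_torsion_free M : hereditarily_separable M -> torsion_free M.
Proof.
move=> hs; have subT : submodule [set: M] by [].
have [T TT] := submodClosed_of_set subT; have [tf _] := hs T.
have inT y : y \in T by rewrite TT; apply/asboolP.
move=> r x rx0; have [|->|/(congr1 val)] := tf r (Sub x (inT x)); last 2 first.
- by left.
- by rewrite SubK linear0; right.
by apply: val_inj; rewrite GRing.valZ linear0 SubK.
Qed.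

End Functionals.

(** * Lifting maps to the fraction field *)

Lemma frac_repr (R : idomainType) (q : {fraction R}) :
  exists a b, b != 0 /\ q = tofrac a / tofrac b.
Proof.
elim/quotW: q => x; exists x.1, x.2; split; first exact: denom_ratioP.
rewrite !piE; apply/eqmodP; rewrite /= /FracField.equivf /FracField.mulf /FracField.invf.
by rewrite !numden_Ratio ?mulr1 ?mul1r ?oner_eq0 ?denom_ratioP // mulrC.
Qed.

Section Localization.
Variables (R : idomainType) (R_PID : is_PID R).
Variables (K : fieldType) (emb : {rmorphism R -> K}).
Hypothesis emb_inj : injective emb.
Hypothesis emb_frac : forall q : K, exists a b, b != 0 /\ q = emb a / emb b.
Local Notation "x %:F" := (emb x).
Implicit Types (p r a b : R) (q : K).

Lemma emb_eq0 a : (a%:F == 0) = (a == 0).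
Proof. by rewrite -(inj_eq emb_inj) rmorph0. Qed.

(** The localization [R_p] as a subring of [K]; [local p (x - y)] is thus equality in [K / R_p]. *)
Definition local p q : Prop := exists a b, ~ divides p b /\ q * b%:F = a%:F.

Lemma pow_local_ex p q : prime_element p -> exists n, local p (p%:F ^+ n * q).
Proof.
move=> pp; have [a [b [b0 ->]]] := emb_frac q.
have [n [b' bE pb']] := prime_exact R_PID pp b0; exists n, a, b'; split=> //.
rewrite bE rmorphM rmorphXn /=; field.
rewrite expf_neq0 ?emb_eq0; last by case: pp.
by apply/eqP => b'0; apply: pb'; rewrite b'0; apply: divides0.
Qed.

Section LocalAt.
Variables (p : R) (pp : prime_element p).

Lemma not_divides_neq0 b : ~ divides p b -> b%:F != 0.
Proof. by move=> pb; rewrite emb_eq0; apply/eqP => b0; apply: pb; rewrite b0; apply: divides0. Qed.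

Lemma local_int a : local p a%:F.
Proof.
exists a, 1; rewrite rmorph1 mulr1; split=> // -[c /esym E].
by case: pp => _ /negP pU _; apply: pU; apply: (@divides_unit _ p 1); [exists c | exact: unitr1].
Qed.

Lemma localD x y : local p x -> local p y -> local p (x + y).
Proof.
move=> [a [b [pb xE]]] [c [d [pd yE]]]; exists (a * d + c * b), (b * d).
split; first exact: prime_not_divides_mul.
by rewrite rmorphD !rmorphM /= -xE -yE; ring.
Qed.

Lemma localM x y : local p x -> local p y -> local p (x * y).
Proof.
move=> [a [b [pb xE]]] [c [d [pd yE]]]; exists (a * c), (b * d).
split; first exact: prime_not_divides_mul.
by rewrite !rmorphM /= -xE -yE; ring.
Qed.

Lemma localN x : local p x -> local p (- x).
Proof. by move=> lx; rewrite -mulN1r -(rmorph1 emb) -rmorphN; apply/localM/lx/local_int. Qed.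

Lemma localB x y : local p x -> local p y -> local p (x - y).
Proof. by move=> lx /localN; apply: localD. Qed.

Lemma localB_sym x y : local p (x - y) -> local p (y - x).
Proof. by move=> /localN; rewrite opprB. Qed.

Lemma localDr x y : local p x -> local p (x + y) -> local p y.
Proof. by move=> lx lxy; have := localB lxy lx; rewrite addrC addKr. Qed.

Lemma local_inv a : ~ divides p a -> local p (a%:F)^-1.
Proof.
by move=> pa; exists 1, a; rewrite mulVf ?rmorph1 // not_divides_neq0.
Qed.

Lemma local_div_exp a n : local p (a%:F / p%:F ^+ n) <-> divides (p ^+ n) a.
Proof.
have p0 : p%:F != 0 by rewrite emb_eq0; case: pp.
split=> [[c [b [pb E]]]|[c ->]]; last first.
  by rewrite rmorphM rmorphXn /= mulfK ?expf_neq0 //; exact: local_int.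
apply: (prime_exp_divides pp pb); exists c; apply/eqP.
rewrite -(inj_eq emb_inj) !rmorphM rmorphXn /= -E; apply/eqP.
by field; rewrite expf_neq0.
Qed.

End LocalAt.

Section Lifting.
Variables (M : lmodType R) (hsM : hereditarily_separable M) (p : R) (pp : prime_element p).

Definition Klinear (g : M -> K) : Prop :=
  forall r x y, g (r *: x + y) = r%:F * g x + g y.

Section KlinearTheory.
Variables (g : M -> K) (gL : Klinear g).

Lemma Klinear0 : g 0 = 0.
Proof. by have := gL (-1) 0 0; rewrite scaler0 addr0 rmorphN rmorph1 mulN1r addNr. Qed.

Lemma KlinearD x y : g (x + y) = g x + g y.
Proof. by rewrite -{1}[x]scale1r gL rmorph1 mul1r. Qed.

Lemma KlinearZ r x : g (r *: x) = r%:F * g x.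
Proof. by rewrite -[_ *: x]addr0 gL Klinear0 addr0. Qed.

Lemma KlinearB x y : g (x - y) = g x - g y.
Proof. by rewrite KlinearD -scaleN1r KlinearZ rmorphN rmorph1 mulN1r. Qed.

Lemma Klinear_sum (I : Type) (l : seq I) (F : I -> M) :
  g (\sum_(i <- l) F i) = \sum_(i <- l) g (F i).
Proof. by elim/big_ind2: _ => [|x a y b <- <-|//]; [exact: Klinear0 | exact: KlinearD]. Qed.

End KlinearTheory.

(* The class of phi in Hom(M, K / R_p) need not lift to Hom(M, K), but up to
   an automorphism of its image it does. *)
Lemma local_lift (phi : M -> K) :
  (forall r x y, local p (phi (r *: x + y) - (r%:F * phi x + phi y))) ->
  exists g : M -> K, [/\ Klinear g, forall m, local p (g m) <-> local p (phi m)
    & forall m, local p (phi m) -> exists r, g m = r%:F].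
Proof.
move=> phiL; pose S := [set m | local p (phi m)].
have p0 : p%:F != 0 by rewrite emb_eq0; case: pp.
have phi0 : local p (phi 0).
  have := localN pp (phiL 1 0 0); rewrite scaler0 addr0 rmorph1 mul1r.
  by rewrite opprD opprK addrA addNr add0r.
have subS : submodule S.
  split=> // r x y Sx Sy; apply: (localDr pp (localN pp (localD pp (localM pp (local_int pp r) Sx) Sy))).
  by rewrite addrC; exact: phiL.
have phiZ r x : local p (phi (r *: x) - r%:F * phi x).
  have := localD pp (phiL r x 0) phi0; rewrite addr0 opprD addrA.
  by rewrite subrK.
have localS r x : local p (r%:F * phi x) -> S (r *: x).
  by move=> rx; have := localD pp (phiZ r x) rx; rewrite subrK.
have tf := hersep_torsion_free hsM.
have powS m : exists n, S (p ^+ n *: m).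
  have [n pn] := pow_local_ex (phi m) pp; exists n; apply: localS.
  by rewrite rmorphXn.
(* An element outside [S] has a multiple whose class in [M / S] is nonzero and killed by [p]. *)
have step m : ~ S m -> exists n, ~ S (p ^+ n *: m) /\ S (p ^+ n.+1 *: m).
  move=> nSm; have [n pn] := powS m; elim: n pn => [|n IH pn].
    by rewrite expr0 scale1r.
  by have [/IH//|nn] := EM (S (p ^+ n *: m)); exists n.
have [Sall|/existsNP[m0 /step[n0 [nSw Spw]]]] := EM (forall m, S m).
  exists (fun=> 0); split=> [r x y|m|m _]; first by rewrite mulr0 addr0.
    by split=> _; [exact: Sall | have := local_int pp 0; rewrite rmorph0].
  by exists 0; rewrite rmorph0.
set w := p ^+ n0 *: m0 in nSw; rewrite exprS -scalerA -/w in Spw.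
have pM0 (x : M) : p *: x = 0 -> x = 0.
  by move=> /tf[pz|//]; case: pp; rewrite pz eqxx.
(* As [M] is torsion-free and [w] is not in [S], [p *: w] is not in [p S]. The form obtained is not
   divisible by [p] at [p *: w], so its extension will not be local at [w]. *)
have [|chi [chiL pchi]] := hersep_functional hsM subS Spw (p := p).
  move=> y Sy /eqP; rewrite -subr_eq0 -scalerBr => /eqP/pM0/eqP.
  by rewrite subr_eq0 => /eqP wy; apply: nSw; rewrite wy.
have chi0 : chi 0 = 0.
  have := chiL (-1) 0 0 subS.1 subS.1.
  by rewrite scaler0 addr0 mulN1r addNr.
have chiZ r x : S x -> chi (r *: x) = r * chi x.
  by move=> Sx; have := chiL r x 0 Sx subS.1; rewrite addr0 chi0 addr0.
have /choice[k kS] := powS.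
(* A power of [p] carries each [m] into [S], so [chi] extends to [M] with values in [K]; [gE] shows
   that the exponent does not matter. *)
pose g m := (chi (p ^+ k m *: m))%:F / p%:F ^+ k m.
have gE m n : S (p ^+ n *: m) -> p%:F ^+ n * g m = (chi (p ^+ n *: m))%:F.
  move=> Sn; apply: (mulfI (expf_neq0 (k m) p0)).
  have := congr1 emb (chiZ (p ^+ k m) _ Sn).
  rewrite scalerA mulrC -scalerA chiZ // !rmorphM !rmorphXn /= => E.
  rewrite mulrCA /g [X in _ * X]mulrC mulfVK ?expf_neq0 //.
have gS m : S m -> g m = (chi m)%:F.
  by move=> Sm; have := @gE m 0%N; rewrite expr0 scale1r mul1r; apply.
have powSle m n n' : S (p ^+ n *: m) -> (n <= n')%N -> S (p ^+ n' *: m).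
  by move=> Sn /subnK <-; rewrite exprD -scalerA; apply: submoduleZ.
have gL : Klinear g.
  move=> r x y; pose n := maxn (k x) (k y).
  have Sx := powSle _ _ _ (kS x) (leq_maxl (k x) (k y)).
  have Sy := powSle _ _ _ (kS y) (leq_maxr (k x) (k y)).
  apply: (mulfI (expf_neq0 n p0)).
  have E : p ^+ n *: (r *: x + y) = r *: (p ^+ n *: x) + p ^+ n *: y.
    by rewrite scalerDr !scalerA [_ * r]mulrC.
  rewrite gE ?E; last exact: subS.2.
  by rewrite chiL // rmorphD rmorphM /= -!gE // mulrDr; congr (_ + _); rewrite mulrCA.
have gSm m : S m -> exists r, g m = r%:F by move=> /gS ->; exists (chi m).
exists g; split=> // m; split=> [lgm|Sm]; last first.
  by have [r ->] := gSm m Sm; exact: local_int.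
apply: contrapT => /step[n [nSm Spm]].
set m' := p ^+ n *: m in nSm; rewrite exprS -scalerA -/m' in Spm.
have lgm' : local p (g m').
  by rewrite KlinearZ //; apply: localM => //; exact: local_int.
have lp x : S (p *: x) -> local p (p%:F * phi x).
  by move=> Spx; have := localD pp (localB_sym pp (phiZ p x)) Spx; rewrite subrK.
(* [M / S] embeds in [K / R_p], whose elements killed by [p] form a line over [R / p]. So [w] is a
   multiple [a *: m'] modulo [S], where [a] is computed from [p * phi m' = a1 / v1],
   [p * phi w = b1 / v2] and an inverse [v] of [a1 * v2] modulo [p]. *)
have [a1 [v1 [pv1 E1]]] := lp m' Spm; have [b1 [v2 [pv2 E2]]] := lp w Spw.
have v10 := not_divides_neq0 pv1; have v20 := not_divides_neq0 pv2.
have pa1 : ~ divides p a1.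
  move=> [c cE]; apply: nSm; exists c, v1; split=> //.
  by apply: (mulfI p0); rewrite mulrA E1 cE rmorphM /= mulrC.
have [u [v uv]] := prime_coprime R_PID pp (prime_not_divides_mul pp pa1 pv2).
pose a := v * b1 * v1.
have Sa : S (a *: m' - w).
  have -> : a *: m' - w = (-1) *: w + a *: m' by rewrite scaleN1r addrC.
  suff l2 : local p ((-1)%:F * phi w + phi (a *: m')).
    by have := localD pp (phiL (-1) w (a *: m')) l2; rewrite subrK.
  have -> : (-1)%:F * phi w + phi (a *: m') =
      (phi (a *: m') - a%:F * phi m') + (a%:F * phi m' - phi w).
    by rewrite rmorphN rmorph1; ring.
  apply: localD => //; exists (- (b1 * v1 * u)), (v1 * v2).
  split; first exact: prime_not_divides_mul.
  apply: (mulfI p0); rewrite !rmorphM rmorphN !rmorphM /=.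
  have -> : p%:F * ((v%:F * b1%:F * v1%:F * phi m' - phi w) * (v1%:F * v2%:F)) =
    v%:F * b1%:F * v1%:F * v2%:F * (p%:F * phi m' * v1%:F) - v1%:F * (p%:F * phi w * v2%:F).
    by ring.
  rewrite E1 E2 -!rmorphM -rmorphB -rmorphN -!rmorphM /=; congr (_ %:F).
  have -> : v * b1 * v1 * v2 * a1 - v1 * b1 = v1 * b1 * (v * (a1 * v2) - 1) by ring.
  by rewrite -uv; ring.
(* If [g m'] is local, so is [g w], which equals [chi (p *: w)] divided by [p]: this contradicts the
   choice of [chi]. *)
have [r gr] := gSm _ Sa; apply: pchi.
have lgw : local p (g w).
  have -> : g w = a%:F * g m' - r%:F by rewrite -gr KlinearB // KlinearZ // opprB addrC subrK.
  by apply: localB => //; [apply: localM => // |]; exact: local_int.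
have gw : g w = (chi (p *: w))%:F / p%:F ^+ 1.
  by rewrite expr1 -(@gE w 1%N) ?expr1 // mulrC mulKf.
by move: lgw; rewrite gw => /(local_div_exp pp); rewrite expr1.
Qed.

End Lifting.
End Localization.

(** * Divisibility modulo a submodule *)

Section PureClosure.
Variables (R : idomainType) (R_PID : is_PID R).
Variables (M : lmodType R).
Implicit Types (A B W : set M) (xs : seq M) (r : R) (x y z m : M) (p : R).

Definition span A : set M := [set m | exists2 l : seq (R * M),
  forall i, i \in l -> A i.2 & m = \sum_(i <- l) i.1 *: i.2].

Definition purecl A : set M := [set m | exists2 r, r != 0 & span A (r *: m)].

Definition is_pure W : Prop := forall r m, r != 0 -> W (r *: m) -> W m.

Definition lcomb xs (c : nat -> R) : M := \sum_(i < size xs) c i *: xs`_i.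

Lemma span_submodule A : submodule (span A).
Proof.
split; first by exists [::]; rewrite ?big_nil.
move=> r x y [l lA ->] [k kA ->]; exists ([seq (r * i.1, i.2) | i <- l] ++ k).
  by move=> i; rewrite mem_cat => /orP[/mapP[j /lA Aj ->]|/kA].
rewrite big_cat big_map /= scaler_sumr; congr (_ + _).
by apply: eq_bigr => i _; rewrite scalerA.
Qed.

Lemma span_self A x : A x -> span A x.
Proof. by exists [:: (1, x)] => [i|]; rewrite ?big_seq1 ?scale1r // inE => /eqP ->. Qed.

Lemma span_sub A W : submodule W -> A `<=` W -> span A `<=` W.
Proof.
move=> subW AW m [l lA ->]; apply: submodule_sum => // i il.
by apply: (submoduleZ subW); apply: AW; apply: lA.
Qed.

Lemma purecl_submodule A : submodule (purecl A).
Proof.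
split; first by exists 1; rewrite ?oner_eq0 // scaler0; exact: (span_submodule A).1.
move=> r x y [a a0 ax] [b b0 bY]; exists (a * b); first by rewrite mulf_neq0.
have -> : (a * b) *: (r *: x + y) = (b * r) *: (a *: x) + a *: (b *: y).
  by rewrite scalerDr !scalerA; congr (_ *: _ + _); ring.
by apply: (span_submodule A).2 => //; apply: submoduleZ => //; exact: span_submodule.
Qed.

Lemma purecl_self A x : A x -> purecl A x.
Proof. by move=> Ax; exists 1; rewrite ?oner_eq0 // scale1r; exact: span_self. Qed.

Lemma purecl_pure A : is_pure (purecl A).
Proof.
by move=> r m r0 [a a0 arm]; exists (a * r); rewrite ?mulf_neq0 // -scalerA.
Qed.

Lemma purecl_min A W : submodule W -> is_pure W -> A `<=` W -> purecl A `<=` W.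
Proof.
by move=> subW pW AW m [r r0 rm]; apply: (pW r) => //; apply: span_sub rm.
Qed.

Lemma purecl_sub A B : A `<=` purecl B -> purecl A `<=` purecl B.
Proof. by apply: purecl_min; [exact: purecl_submodule | exact: purecl_pure]. Qed.

Lemma purecl_mono A B : A `<=` B -> purecl A `<=` purecl B.
Proof. by move=> AB; apply: purecl_sub => x /AB; apply: purecl_self. Qed.

Lemma purecl_finite A m : purecl A m -> exists2 s : seq M,
  forall x, x \in s -> A x & purecl [set` s] m.
Proof.
move=> [r r0 [l lA rm]]; exists [seq i.2 | i <- l].
  by move=> x /mapP[i /lA Ai ->].
by exists r => //; exists l => // i il /=; apply: map_f.
Qed.

Lemma lcomb_sub W xs c : submodule W -> (forall x, x \in xs -> W x) -> W (lcomb xs c).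
Proof.
move=> subW xsW; apply: submodule_sum => // i _.
by apply: (submoduleZ subW); apply: xsW; apply: mem_nth.
Qed.

Lemma lcombD xs c d : lcomb xs c + lcomb xs d = lcomb xs (fun i => c i + d i).
Proof. by rewrite -big_split; apply: eq_bigr => i _; rewrite scalerDl. Qed.

Lemma lcombZ xs r c : r *: lcomb xs c = lcomb xs (fun i => r * c i).
Proof. by rewrite scaler_sumr; apply: eq_bigr => i _; rewrite scalerA. Qed.

Lemma span_setU A xs m : submodule A ->
  span (A `|` [set` xs]) m <-> exists a c, A a /\ m = a + lcomb xs c.
Proof.
move=> subA; split=> [|[a [c [Aa ->]]]]; last first.
  apply: submoduleD; [exact: span_submodule | by apply: span_self; left |].
  apply: lcomb_sub; first exact: span_submodule.
  by move=> x xxs; apply: span_self; right.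
pose W := [set m | exists a c, A a /\ m = a + lcomb xs c].
suff : span (A `|` [set` xs]) `<=` W by apply.
apply: span_sub.
  split.
    exists 0, (fun=> 0); rewrite add0r /lcomb big1 ?scale0r //; first by split=> //; exact: subA.1.
    by move=> i _; rewrite scale0r.
  move=> r _ _ [a [c [Aa ->]]] [b [d [Ab ->]]].
  exists (r *: a + b), (fun i => r * c i + d i); split; first exact: subA.2.
  by rewrite scalerDr lcombZ addrACA lcombD.
move=> x [Ax|/= xxs]; first by exists x, (fun=> 0); rewrite /lcomb big1 ?addr0 // => i _; rewrite scale0r.
have ix : (index x xs < size xs)%N by rewrite index_mem.
exists 0, (fun i => (i == index x xs)%:R); split; first exact: subA.1.
rewrite add0r /lcomb (bigD1 (Ordinal ix)) //= eqxx scale1r nth_index // big1 ?addr0 //.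
by move=> i /negbTE; rewrite -val_eqE /= => ->; rewrite scale0r.
Qed.

Section CyclicStep.
Hypothesis R_fin_primes : finitely_many_primes R.

(** Dividing [y] modulo [W] by the highest possible power of each of the finitely many primes leaves
    an element that no prime divides modulo [W]. In a torsion-free quotient of rank one such an
    element is a generator. *)
Lemma cyclic_step W y : submodule W -> is_pure W ->
  (forall p x, prime_element p -> ~ W x -> exists n, forall z, ~ W (p ^+ n *: z - x)) ->
  exists2 b, purecl (W `|` [set y]) b &
    forall m, purecl (W `|` [set y]) m -> exists r, W (m - r *: b).
Proof.
move=> subW pW Wdiv; have [Wy|nWy] := EM (W y).
  exists 0; first exact: (purecl_submodule _).1.
  move=> m mW; exists 0; rewrite scaler0 subr0; move: m mW.
  by apply: purecl_min => // x [//|/= ->].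
have [ps psP] := R_fin_primes.
(* Induction on the list of primes: dividing by a further prime keeps the element indivisible by the
   earlier ones. *)
have [y1 [ry1 [nWy1 Wry1 y1div]]] : exists y1 r, [/\ ~ W y1, W (r *: y1 - y) &
    forall q, q \in ps -> prime_element q -> forall z, ~ W (q *: z - y1)].
  elim: ps {psP} => [|q ps [y1 [r [nWy1 Wry1 y1div]]]].
    by exists y, 1; split=> //; rewrite scale1r subrr; exact: subW.1.
  have [qp|nqp] := EM (prime_element q); last first.
    by exists y1, r; split=> // q'; rewrite inE => /orP[/eqP -> //|]; exact: y1div.
  have [n nq] := Wdiv q y1 qp nWy1.
  have [e [y2 y2E] nqe] : exists2 e, exists z, W (q ^+ e *: z - y1) &
      forall z, ~ W (q ^+ e.+1 *: z - y1).
    elim: n nq => [nq|n IH nq].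
      by case: (nq y1); rewrite expr0 scale1r subrr; exact: subW.1.
    have [?|/forallNP/IH//] := EM (exists z, W (q ^+ n *: z - y1)).
    by exists n.
  exists y2, (r * q ^+ e); split.
  - move=> Wy2; apply: nWy1; have := submoduleB subW (submoduleZ subW (q ^+ e) Wy2) y2E.
    by rewrite opprB addrC subrK.
  - have := submoduleD subW (submoduleZ subW r y2E) Wry1.
    by rewrite scalerBr scalerA addrA subrK.
  - have tr c z : W (c *: z - y2) -> W ((q ^+ e * c) *: z - y1).
      move=> Wc; have := submoduleD subW (submoduleZ subW (q ^+ e) Wc) y2E.
      by rewrite scalerBr scalerA addrA subrK.
    move=> q'; rewrite inE => /orP[/eqP ->|q'ps] q'p z /tr.
      by rewrite -exprSr; apply: nqe.
    by rewrite mulrC -scalerA; apply: y1div.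
have y1cl : purecl (W `|` [set y]) y1.
  have r0 : ry1 != 0.
    apply: contra_notN nWy => /eqP r0; rewrite -[y]opprK; apply: submoduleN => //.
    by move: Wry1; rewrite r0 scale0r add0r.
  apply: (purecl_pure r0); rewrite -[_ *: _](subrK y); apply: submoduleD.
  - exact: purecl_submodule.
  - by apply: purecl_self; left.
  - by apply: purecl_self; right.
exists y1 => // m [r r0 rm].
have [s Ws] : exists s, W (r *: m - s *: y1).
  have subWs : submodule [set m | exists s, W (m - s *: y1)].
    split; first by exists 0; rewrite scale0r subr0; exact: subW.1.
    move=> t a b [s Wa] [s' Wb]; exists (t * s + s').
    have := subW.2 t _ _ Wa Wb.
    by rewrite scalerBr scalerA addrACA -opprD -scalerDl.
  apply: (span_sub subWs) rm => x [Wx|/= ->].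
    by exists 0; rewrite scale0r subr0.
  by exists ry1; rewrite -opprB; apply: submoduleN.
have [g [[r' rE] [s' sE] [u [v gE]]]] := bezout R_PID r s.
have g0 : g != 0 by apply: contra_neq r0 => g0; rewrite rE g0 mulr0.
have r'0 : r' != 0 by apply: contra_neq r0 => r'0; rewrite rE r'0 mul0r.
have Wrs : W (r' *: m - s' *: y1).
  by apply: (pW g) => //; rewrite scalerBr !scalerA ![g * _]mulrC -rE -sE.
have uv1 : u * r' + v * s' = 1.
  by apply: (mulIf g0); rewrite mulrDl -!mulrA -rE -sE -gE mul1r.
(* As [r'] and [s'] are coprime, [r'] divides [y1] modulo [W]. Were it not a unit, one of its prime
   factors would divide [y1] too. *)
have Wz : W (r' *: (u *: y1 + v *: m) - y1).
  have := submoduleZ subW v Wrs; congr W.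
  rewrite -[X in _ = _ - X]scale1r -uv1 scalerBr scalerDr scalerDl !scalerA.
  rewrite opprD addrA [r' * u]mulrC [r' * v]mulrC.
  by rewrite [X in _ = X - _]addrAC subrr add0r.
have r'U : r' \is a GRing.unit.
  apply: contrapT => /negP r'U; have [q qp [c r'E]] := prime_divisor R_PID r'0 r'U.
  have [q' q'ps [w wU qE]] := psP q qp; have q'p : prime_element q'.
    have [q0 qU qP] := qp; have dqq' : q' = w^-1 * q by rewrite qE mulKr.
    split; first by apply: contra_neq q0 => q'0; rewrite qE q'0 mulr0.
      by apply: contra qU => q'U; rewrite qE unitrM wU.
    have d' a : divides q a -> divides q' a.
      by move=> [d ->]; exists (d * w); rewrite qE mulrA.
    move=> a b [d dE]; have [|/d'|/d'] := qP a b; [|by left|by right].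
    by exists (d * w^-1); rewrite dE dqq' mulrA.
  apply: (y1div q' q'ps q'p ((c * w) *: (u *: y1 + v *: m))).
  by rewrite scalerA [q' * _]mulrC -mulrA -qE -r'E.
exists (r'^-1 * s'); have := submoduleZ subW r'^-1 Wrs.
by rewrite scalerBr !scalerA mulVr // scale1r.
Qed.

Definition divisible_mod A p xs x : Prop :=
  [/\ prime_element p, ~ purecl (A `|` [set` xs]) x &
      forall n, exists z, purecl (A `|` [set` xs]) (p ^+ n *: z - x)].

(** For a pure submodule [A], the failure of Pontryagin's criterion for [M / A]: with finitely many
    primes, a non-free torsion-free module of finite rank has a quotient by a pure submodule with a
    nonzero element divisible by all powers of some prime. *)
Definition not_aleph1_free_mod A : Prop := exists p xs x, divisible_mod A p xs x.

(* Coordinates of a divisible_mod witness with xs as short as possible: [x] is divisible by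
   every [p ^+ n] modulo [A] and the [xs], with quotient [z n]. The last clause says that the
   submodule spanned by [A], [x], the [xs] and the [z n] has no nonzero linear form vanishing on [A]. *)
Definition witness A p xs x (z s : nat -> M) (u : nat -> nat -> R) : Prop :=
  [/\ prime_element p,
      forall n, A (s n) /\ p ^+ n *: z n = x + lcomb xs (u n) - s n,
      forall (c0 : R) (c : nat -> R), A (c0 *: x + lcomb xs c) -> c0 = 0 /\ forall i, (i < size xs)%N -> c i = 0 &
      forall (m0 : R) (m : nat -> R), (forall n, divides (p ^+ n.+1) (m0 + \sum_(i < size xs) u n.+1 i * m i)) ->
        m0 = 0 /\ forall i, (i < size xs)%N -> m i = 0].

Lemma divisible_mod_minimal A : not_aleph1_free_mod A -> exists p xs x, divisible_mod A p xs x /\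
  forall p' xs' x', divisible_mod A p' xs' x' -> (size xs <= size xs')%N.
Proof.
move=> [p [xs [x w]]]; move: {2}(size xs) (leqnn (size xs)) => n.
elim: n p xs x w => [|n IH] p xs x w szn.
  by exists p, xs, x; split=> // *; apply: leq_trans szn _.
have [[p' [xs' [x' [w' sz']]]]|nw] :=
    EM (exists p' xs' x', divisible_mod A p' xs' x' /\ (size xs' < size xs)%N).
  by apply: IH w' _; rewrite -ltnS; apply: leq_trans szn.
exists p, xs, x; split=> // p' xs' x' w'; rewrite leqNgt; apply/negP => sz'.
by apply: nw; exists p', xs', x'.
Qed.

(** The elements of [xs] are added one at a time. Each step is cyclic, since otherwise [cyclic_step]
    points to an element divisible modulo [A] and a proper initial segment of [xs], against
    minimality. *)
Lemma minimal_basis A xs : submodule A -> is_pure A ->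
  (forall p' xs' x', divisible_mod A p' xs' x' -> (size xs <= size xs')%N) ->
  exists2 xs', size xs' = size xs & forall m, purecl (A `|` [set` xs]) m <->
    exists a c, A a /\ m = a + lcomb xs' c.
Proof.
move=> subA pA mins.
suff : forall k, (k <= size xs)%N -> exists2 xs', size xs' = k &
    forall m, purecl (A `|` [set` take k xs]) m <-> exists a c, A a /\ m = a + lcomb xs' c.
  by move=> /(_ (size xs) (leqnn _)); rewrite take_size.
elim=> [_|k IH kxs].
  exists [::] => // m; rewrite take0; split=> [mA|[a [c [Aa ->]]]].
    exists m, (fun=> 0); rewrite /lcomb big_ord0 addr0; split=> //.
    by move: m mA; apply: purecl_min => // x [].
  by rewrite /lcomb big_ord0 addr0; apply: purecl_self; left.
have [xs' sz' xs'P] := IH (ltnW kxs).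
set W := purecl _ in xs'P.
have [||p x pp nWx|b bW bE] := @cyclic_step W xs`_k.
- exact: purecl_submodule.
- exact: purecl_pure.
- apply: contrapT => /forallNP nd; have := mins p (take k xs) x.
  rewrite size_takel ?(ltnW kxs) // leqNgt kxs => h; suff : false by []. apply: h.
  by split=> // n; apply: contrapT => /forallNP nz; exact: (nd n).
have tE : [set` take k.+1 xs] = [set` take k xs] `|` [set xs`_k].
  apply/predeqP => x /=; rewrite (take_nth 0) // mem_rcons inE.
  by split=> [/orP[/eqP ->|xk]|[->|/= ->]]; rewrite ?eqxx ?orbT //; [right|left].
have clE : purecl (A `|` [set` take k.+1 xs]) = purecl (W `|` [set xs`_k]).
  apply/predeqP => m; split; last first.
    apply: purecl_sub => x [|/= ->].
      by apply: purecl_mono => y [Ay|yk]; [left|right; rewrite tE; left].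
    by apply: purecl_self; right; rewrite tE; right.
  apply: purecl_sub => x [Ax|]; first by apply: purecl_self; left; apply: purecl_self; left.
  rewrite tE => -[xk|->]; last by apply: purecl_self; right.
  by apply: purecl_self; left; apply: purecl_self; right.
have lcE c : lcomb (rcons xs' b) c = lcomb xs' c + c k *: b.
  rewrite /lcomb size_rcons big_ord_recr /= nth_rcons ltnn eqxx sz'; congr (_ + _).
  by apply: eq_bigr => i _; rewrite nth_rcons sz' ltn_ord.
exists (rcons xs' b) => [|m]; first by rewrite size_rcons sz'.
rewrite clE; split=> [/bE[r]|[a [c [Aa ->]]]].
  move=> /xs'P[a [c [Aa mE]]]; exists a, (fun i => if i == k then r else c i); split=> //.
  rewrite lcE eqxx addrA -[m](subrK (r *: b)) mE; congr (_ + _ + _).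
  by apply: eq_bigr => i _; rewrite ltn_eqF // -sz'.
rewrite lcE addrA; apply: submoduleD; first exact: purecl_submodule.
  by apply: purecl_self; left; apply/xs'P; exists a, c.
by apply: submoduleZ => //; exact: purecl_submodule.
Qed.

(** Minimality gives the rigidity: a relation modulo [A] would make one of the [xs] redundant, and a
    linear form violating the last clause would allow replacing the data by data in its kernel, of
    smaller rank. *)
Lemma witness_ex A : submodule A -> is_pure A -> not_aleph1_free_mod A ->
  exists p xs x (z s : nat -> M) u, witness A p xs x z s u.
Proof.
move=> subA pA /divisible_mod_minimal[p [xs0 [x [[pp nx0 xdiv0] mins0]]]].
have [xs szxs xsP] := minimal_basis subA pA mins0.
have lc1 ys (i : nat) : (i < size ys)%N -> lcomb ys (fun j => (j == i)%:R) = ys`_i.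
  move=> iys; rewrite /lcomb (bigD1 (Ordinal iys)) //= eqxx scale1r big1 ?addr0 //.
  by move=> j /negbTE; rewrite -val_eqE /= => ->; rewrite scale0r.
have clE : purecl (A `|` [set` xs]) = purecl (A `|` [set` xs0]).
  apply/predeqP => m; split; last first.
    by move=> /xsP mE; exists 1; rewrite ?oner_eq0 // scale1r; apply/span_setU.
  apply: purecl_sub => y [Ay|/= yxs]; first by apply: purecl_self; left.
  apply/xsP; exists 0, (fun j => (j == index y xs)%:R); split; first exact: subA.1.
  by rewrite add0r lc1 ?index_mem // nth_index.
rewrite -clE in nx0 xdiv0; rewrite -szxs in mins0.
have /choice[z zP] n : exists z, exists sc : M * (nat -> R),
    A sc.1 /\ p ^+ n *: z = x + lcomb xs sc.2 - sc.1.
  have [z] := xdiv0 n; rewrite clE => /xsP[a [c [Aa E]]].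
  exists z, (- a, c); split=> /=; first exact: submoduleN.
  by rewrite opprK -addrA [_ + a]addrC -E addrC subrK.
have /choice[sc scP] := zP.
have clx : forall i, (i < size xs)%N -> purecl (A `|` [set` xs]) xs`_i.
  by move=> i ixs; apply: purecl_self; right; apply: mem_nth.
exists p, xs, x, z, (fun n => (sc n).1), (fun n => (sc n).2); split=> //.
- move=> c0 c Acc.
  have c00 : c0 = 0.
    apply: contrapT => /eqP c00; apply: nx0; apply: (purecl_pure c00).
    rewrite -[_ *: _](addrK (lcomb xs c)).
    apply: submoduleB; [exact: purecl_submodule|by apply: purecl_self; left|].
    by apply: lcomb_sub; [exact: purecl_submodule| move=> y yxs; apply: purecl_self; right].
  split=> // i ixs; apply: contrapT => /eqP ci0.
  move: Acc; rewrite c00 scale0r add0r => Ac.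
  pose ys := [seq xs`_j | j <- rem i (iota 0 (size xs))].
  have szys : (size ys < size xs)%N.
    by rewrite size_map size_rem ?mem_iota // size_iota prednK // (leq_trans _ ixs).
  have jys j : (j < size xs)%N -> j != i -> xs`_j \in ys.
    by move=> jxs ji; apply/map_f; rewrite mem_rem_uniq ?iota_uniq // inE ji mem_iota.
  have icl : purecl (A `|` [set` ys]) xs`_i.
    apply: (purecl_pure ci0).
    have -> : c i *: xs`_i = lcomb xs c - \sum_(j < size xs | j != i :> nat) c j *: xs`_j.
      by rewrite /lcomb (bigD1 (Ordinal ixs)) //= addrK.
    apply: submoduleB; [exact: purecl_submodule | by apply: purecl_self; left |].
    rewrite big_mkcond /=; apply: submodule_sum => [|j _]; first exact: purecl_submodule.
    case: ifP => [ji|_]; last exact: (purecl_submodule _).1.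
    apply: submoduleZ; first exact: purecl_submodule.
    by apply: purecl_self; right; apply: jys.
  have ysE : purecl (A `|` [set` ys]) = purecl (A `|` [set` xs]).
    apply/predeqP => m; split; apply: purecl_sub => y [Ay|/= yin];
      try by apply: purecl_self; left.
      move: yin => /mapP[j /mem_rem]; rewrite mem_iota => /andP[_ jxs] ->.
      exact: clx.
    have := yin; rewrite -index_mem => jxs; rewrite -(nth_index 0 yin).
    have [->|ji] := eqVneq (index y xs) i; first exact: icl.
    by apply: purecl_self; right; apply: jys.
  have := mins0 p ys x; rewrite leqNgt szys => h; suff : false by [].
  by apply: h; split; rewrite ?ysE.
move=> m0 m mdiv.
have mi0 i : (i < size xs)%N -> m i = 0.
  move=> ixs; apply: contrapT => /eqP mi0.
  (* View the form as taking the value [m0] at [x] and [m j] at the [j]-th element of [xs]. The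
     [f j] lie in its kernel, and so does the new element that replaces [x]. As [f i] is zero it is
     dropped, which shortens the list. *)
  pose f j := m i *: xs`_j - m j *: xs`_i.
  pose ys := [seq f j | j <- rem i (iota 0 (size xs))].
  have szys : (size ys < size xs)%N.
    by rewrite size_map size_rem ?mem_iota // size_iota prednK // (leq_trans _ ixs).
  have jys j : (j < size xs)%N -> purecl (A `|` [set` ys]) (f j).
    move=> jxs; have [->|ji] := eqVneq j i.
      by rewrite /f subrr; exact: (purecl_submodule _).1.
    by apply: purecl_self; right; apply/map_f; rewrite mem_rem_uniq ?iota_uniq // inE ji mem_iota.
  have ysxs : purecl (A `|` [set` ys]) `<=` purecl (A `|` [set` xs]).
    apply: purecl_sub => y [Ay|/= /mapP[j /mem_rem]]; first by apply: purecl_self; left.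
    rewrite mem_iota => /andP[_ jxs] ->.
    by apply: submoduleB; [exact: purecl_submodule| |];
      apply: submoduleZ; try exact: purecl_submodule; exact: clx.
  have := mins0 p ys (m i *: x - m0 *: xs`_i); rewrite leqNgt szys => h; suff : false by [].
  apply: h; split=> //.
    move=> /ysxs xcl; apply: nx0; apply: (purecl_pure mi0).
    rewrite -[_ *: _](subrK (m0 *: xs`_i)); apply: submoduleD => //.
      exact: purecl_submodule.
    by apply: submoduleZ; [exact: purecl_submodule | exact: clx].
  suff dn n : exists z, purecl (A `|` [set` ys]) (p ^+ n.+1 *: z - (m i *: x - m0 *: xs`_i)).
    move=> n; have [z' z'P] := dn n; exists (p *: z').
    by rewrite scalerA -exprSr.
  have [r rE] := mdiv n.
  have [As zE] := scP n.+1.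
  (* The form takes the value [r] at [z n.+1]; subtracting this multiple moves the quotient into the
     kernel. *)
  exists (m i *: z n.+1 - r *: xs`_i).
  have -> : p ^+ n.+1 *: (m i *: z n.+1 - r *: xs`_i) - (m i *: x - m0 *: xs`_i) =
      \sum_(j < size xs) (sc n.+1).2 j *: f j - m i *: (sc n.+1).1.
    rewrite scalerBr [p ^+ _ *: (m i *: _)]scalerA [_ * m i]mulrC -scalerA zE.
    rewrite [p ^+ _ *: (r *: _)]scalerA [_ * r]mulrC -rE.
    have -> : \sum_(j < size xs) (sc n.+1).2 j *: f j = m i *: lcomb xs (sc n.+1).2 -
        (\sum_(j < size xs) (sc n.+1).2 j * m j) *: xs`_i.
      rewrite /lcomb scaler_sumr scaler_suml -sumrB; apply: eq_bigr => j _.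
      by rewrite /f scalerBr !scalerA [m i * _]mulrC.
    rewrite scalerDl !scalerBr scalerDr.
    set a := m i *: x; set b := m i *: lcomb _ _; set c := m i *: _.
    set d := m0 *: _; set e := _ *: xs`_i.
    rewrite opprD opprB (AC (3*2*2) ((1*7)*(4*6)*2*5*3)) /=.
    by rewrite subrr addNr add0r add0r.
  apply: submoduleB; [exact: purecl_submodule| |].
    apply: submodule_sum => [|j _]; first exact: purecl_submodule.
    by apply: submoduleZ; [exact: purecl_submodule| exact: jys].
  by apply: submoduleZ; [exact: purecl_submodule| by apply: purecl_self; left].
split=> //; have [p0 pU _] := pp; apply: (divides_pow_eq0 R_PID pU) => -[|n].
  by exists m0; rewrite mulr1.
by have := mdiv n; rewrite big1 ?addr0 // => i _; rewrite mi0 ?mulr0.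
Qed.

(** Without [A], a linear form on [M] that is nonzero at [x] violates the last clause of [witness]:
    its value at [p ^+ n *: z n] is divisible by [p ^+ n]. *)
Lemma aleph1_free_mod0 : hereditarily_separable M -> ~ not_aleph1_free_mod [set 0 : M].
Proof.
move=> hsM; have tf := hersep_torsion_free hsM.
have sub0 : submodule [set 0 : M] by split=> // r x y -> ->; rewrite scaler0 addr0.
move=> /(witness_ex sub0)[|p [xs [x [z [s [u [pp zE ind uniq0]]]]]]].
  by move=> r m r0 /= /tf[/eqP|//]; rewrite (negbTE r0).
have x0 y : [set: M] y -> x <> 0 *: y.
  move=> _; rewrite scale0r => x0; have [|/eqP] := ind 1 (fun=> 0); last by rewrite oner_eq0.
  by rewrite /= x0 scaler0 add0r /lcomb big1 // => i _; rewrite scale0r.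
(* The prime is replaced by [0]: not being divisible by [0] means being nonzero. *)
have [|chi [chiL chix]] := @hersep_functional R M 0 [set: M] x hsM _ I x0; first by [].
have chi0 : chi 0 = 0.
  have := chiL (-1) 0 0 I I.
  by rewrite scaler0 addr0 mulN1r addNr.
have chiD y1 y2 : chi (y1 + y2) = chi y1 + chi y2.
  by have := chiL 1 y1 y2 I I; rewrite scale1r mul1r.
have chiZ r y : chi (r *: y) = r * chi y.
  by have := chiL r y 0 I I; rewrite chi0 !addr0.
have [|chix0 _] := uniq0 (chi x) (fun i => chi xs`_i); last first.
  by apply: chix; rewrite chix0; exact: divides0.
move=> n; exists (chi (z n.+1)); have [/= s0 E] := zE n.+1.
move: E; rewrite s0 subr0 => /(congr1 chi); rewrite chiZ chiD mulrC => ->; congr (_ + _).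
rewrite /lcomb; elim/big_ind2: _ => // y1 r1 y2 r2 E1 E2.
by rewrite chiD E1 E2.
Qed.

End CyclicStep.
End PureClosure.

(** * Filtrations and freeness *)

Section WellOrder.
Variables (X : eqType) (le : rel X) (wo : well_order le).

Definition slt x y := ~~ le y x.

Lemma wo_min (P : set X) : (exists x, P x) -> exists2 x, P x & forall y, P y -> le x y.
Proof.
move=> [x Px]; have [|z [[zP zmin] _]] := wo (A := fun x => `[< P x >]).
  by exists x; apply/asboolP.
exists z; first exact/asboolP.
by move=> y Py; apply: zmin; apply/asboolP.
Qed.

Lemma wo_refl : reflexive le.
Proof. by move=> x; have [y <- ymin] := wo_min (ex_intro (eq x) x erefl); exact: ymin. Qed.

Lemma wo_total x y : le x y \/ le y x.
Proof.
have [|z [->|->] zmin] := @wo_min (fun z => z = x \/ z = y); first by exists x; left.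
  by left; apply: zmin; right.
by right; apply: zmin; left.
Qed.

Lemma wo_anti x y : le x y -> le y x -> x = y.
Proof.
move=> xy yx; have [|z [_ zU]] := wo (A := pred2 x y).
  by exists x; rewrite inE eqxx.
have Ux : minimum_of le (pred2 x y) x.
  split; first by rewrite inE eqxx.
  by move=> t; rewrite inE => /orP[/eqP ->|/eqP ->] //; exact: wo_refl.
have Uy : minimum_of le (pred2 x y) y.
  split; first by rewrite inE eqxx orbT.
  by move=> t; rewrite inE => /orP[/eqP ->|/eqP ->] //; exact: wo_refl.
by rewrite -(zU x Ux) -(zU y Uy).
Qed.

Lemma wo_trans x y z : le x y -> le y z -> le x z.
Proof.
move=> xy yz; have [|t tP tmin] := @wo_min (fun t => [\/ t = x, t = y | t = z]).
  by exists x; constructor 1.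
have tx := tmin x (Or31 _ _ erefl); have ty := tmin y (Or32 _ _ erefl).
have tz := tmin z (Or33 _ _ erefl).
case: tP => tE; subst t => //; first by rewrite (wo_anti xy tx).
by rewrite -(wo_anti yz ty).
Qed.

Lemma sltW x y : slt x y -> le x y.
Proof. by rewrite /slt; have [//|->] := wo_total x y. Qed.

Lemma slt_le_trans x y z : slt x y -> le y z -> slt x z.
Proof. by move=> xy yz; apply: contra xy; apply: wo_trans yz. Qed.

Lemma le_slt_trans x y z : le x y -> slt y z -> slt x z.
Proof. by move=> xy yz; apply: contra yz => zx; apply: wo_trans zx xy. Qed.

Lemma slt_irr x : ~ slt x x.
Proof. by rewrite /slt wo_refl. Qed.

Lemma le_eq_slt x y : le x y -> x = y \/ slt x y.
Proof.
move=> xy; have [yx|yx] := boolP (le y x); last by right.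
by left; apply: wo_anti.
Qed.

Lemma slt_neq x y : le x y -> x != y -> slt x y.
Proof. by move=> /le_eq_slt[->|//]; rewrite eqxx. Qed.

Lemma slt_ind (P : X -> Prop) : (forall x, (forall y, slt y x -> P y) -> P x) -> forall x, P x.
Proof.
move=> IH x; apply: contrapT => nPx; have [y nPy ymin] := wo_min (ex_intro (fun x => ~ P x) x nPx).
by apply: nPy; apply: IH => z; apply: contraPP => /ymin; rewrite /slt => ->.
Qed.

Lemma wo_max_seq (I : eqType) (f : I -> X) (s : seq I) : s != [::] ->
  exists2 i, i \in s & forall j, j \in s -> le (f j) (f i).
Proof.
elim: s => // i [_ _|j s IH _].
  by exists i; rewrite ?inE // => j; rewrite inE => /eqP ->; exact: wo_refl.
have [//|k ks kmax] := IH.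
have [ik|ki] := wo_total (f i) (f k).
  by exists k; rewrite 1?inE ?ks ?orbT // => l; rewrite inE => /orP[/eqP -> //|/kmax].
exists i; rewrite ?inE ?eqxx // => l; rewrite inE => /orP[/eqP ->|/kmax lk]; first exact: wo_refl.
exact: wo_trans lk ki.
Qed.

Section Lexicographic.
Variables (K : eqType) (rho : K -> X).
Hypothesis fiber_countable : forall x, countable [set k | rho k = x].

(** Each fibre is ordered in type at most omega, so an initial segment consists of whole lower
    fibres and a finite list. The finite list will serve as the [xs] of [divisible_mod]. *)
Lemma lexicographic : exists le' : rel K, [/\ well_order le',
  forall k k', le' k k' -> le (rho k) (rho k') &
  forall k, exists s : seq K, forall k', le' k' k /\ k' <> k <-> slt (rho k') (rho k) \/ k' \in s].
Proof.
have /choice[f fP] x : exists f : K -> nat, {in [set k | rho k = x] &, injective f}.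
  exact/countable_injP.
pose idx k := f (rho k) k.
have idxI k k' : rho k = rho k' -> idx k = idx k' -> k = k'.
  by move=> E; rewrite /idx E; apply: fP; rewrite inE.
pose le' k k' := slt (rho k) (rho k') || ((rho k == rho k') && (idx k <= idx k')%N).
have le'le k k' : le' k k' -> le (rho k) (rho k').
  by move=> /orP[/sltW //|/andP[/eqP -> _]]; exact: wo_refl.
have anti : antisymmetric le'.
  move=> k k' /andP[kk k'k].
  have E : rho k = rho k' by apply: wo_anti; exact: le'le.
  apply: idxI => //; apply/anti_leq.
  by move: kk k'k; rewrite /le' E eqxx /slt wo_refl /= => -> ->.
exists le'; split=> // [|k].
  apply: antisymmetric_well_order => // A [k0 k0A].
  have [|_ [k1 k1A <-] xmin] := @wo_min [set rho k | k in [set k | k \in A]].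
    by exists (rho k0), k0.
  pose Q n := `[< exists2 k, k \in A & rho k = rho k1 /\ idx k = n >].
  have exQ : exists n, Q n by exists (idx k1); apply/asboolP; exists k1.
  have [n /asboolP[k kA [kk1 kn]] nmin] := ex_minnP exQ.
  exists k; split=> // k' k'A; rewrite /le' kk1.
  have k1k' : le (rho k1) (rho k') by apply: xmin; exists k'.
  have [E|->//] := le_eq_slt k1k'.
  by rewrite -E eqxx kn nmin ?orbT //; apply/asboolP; exists k'.
have /choice[g gP] n : exists k', (exists2 k1, rho k1 = rho k & idx k1 = n) ->
    rho k' = rho k /\ idx k' = n.
  by have [[k1 ? ?]|] := EM (exists2 k1, rho k1 = rho k & idx k1 = n); [exists k1|exists k].
exists [seq g n | n <- iota 0 (idx k) & `[< exists2 k1, rho k1 = rho k & idx k1 = n >]].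
move=> k'; split=> [[/orP[|/andP[/eqP E le_idx]] nk]|]; first by left.
  right; apply/mapP; exists (idx k').
    rewrite mem_filter mem_iota /= add0n ltn_neqAle le_idx andbT; apply/andP; split.
      by apply/asboolP; exists k'.
    by apply/eqP => /(idxI _ _ E).
  have [|gr gi] := gP (idx k'); first by exists k'.
  by apply: idxI; rewrite ?gr ?gi.
move=> [kk|/mapP[n]]; first by split; [rewrite /le' kk | move=> E; move: kk; rewrite E; apply: slt_irr].
rewrite mem_filter mem_iota /= add0n => /andP[/asboolP nk nlt] ->; have [gr gi] := gP n nk.
split; first by rewrite /le' gr eqxx gi (ltnW nlt) orbT.
by move=> gk; rewrite -gk gi ltnn in nlt.
Qed.

End Lexicographic.

Lemma countable_bounded (C : set X) : ~ countable [set: X] ->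
  (forall x, countable [set y | le y x]) -> countable C -> exists u, forall c, C c -> slt c u.
Proof.
move=> unX cX cC; apply: contrapT => nb; apply: unX.
have -> : [set: X] = \bigcup_(c in C) [set y | le y c].
  apply/predeqP => x; split=> // _; apply: contrapT => nx; apply: nb; exists x => c Cc.
  by rewrite /slt; apply/negP => xc; apply: nx; exists c.
by apply: bigcup_countable.
Qed.

End WellOrder.

Section Freeness.
Variables (R : idomainType) (R_PID : is_PID R) (R_fin_primes : finitely_many_primes R).
Variables (M : lmodType R) (tf : torsion_free M).

Lemma span_lin (A : {pred M}) m : span [set x | x \in A] m ->
  exists (s : seq M) (c : M -> R), {subset s <= A} /\ m = \sum_(x <- s) c x *: x.
Proof.
move=> [l lA ->]; exists (undup [seq i.2 | i <- l]).
exists (fun x => \sum_(i <- l | i.2 == x) i.1); split.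
  by move=> x; rewrite mem_undup => /mapP[i /lA Ai ->].
under [RHS]eq_bigr do rewrite scaler_suml.
rewrite (exchange_big_dep xpredT) //= big_seq [RHS]big_seq; apply: eq_bigr => i il.
rewrite -big_filter (@eq_filter _ _ (pred1 i.2)) => [|x]; last by rewrite /= eq_sym.
by rewrite filter_pred1_uniq ?undup_uniq ?big_seq1 // mem_undup map_f.
Qed.

(** The pure closures of the initial segments form a chain with cyclic quotients, and the generators
    at the places where it grows form a basis. The chain is continuous because every element of a
    pure closure lies in that of a finite subset. *)
Lemma free_of_cyclic_steps (le : rel M) : well_order le ->
  (forall m, exists2 b, purecl ([set x | le x m /\ x <> m] `|` [set m]) b &
     forall z, purecl ([set x | le x m /\ x <> m] `|` [set m]) z ->
       exists r, purecl [set x | le x m /\ x <> m] (z - r *: b)) ->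
  is_free M.
Proof.
move=> wo step; pose P m := [set x | le x m /\ x <> m].
have /choice[b bP] m : exists b, purecl (P m `|` [set m]) b /\
    forall z, purecl (P m `|` [set m]) z -> exists r, purecl (P m) (z - r *: b).
  by have [b] := step m; exists b.
have subP m : submodule (purecl (P m)) by exact: purecl_submodule.
have bnP m : ~ purecl (P m) m -> ~ purecl (P m) (b m).
  move=> nm bm; apply: nm; have [_ /(_ m)[|r mr]] := bP m; first by apply: purecl_self; right.
  by have := submoduleD (subP m) mr (submoduleZ (subP m) r bm); rewrite subrK.
have Pm m m' : le m' m -> m' <> m -> P m' `|` [set m'] `<=` P m.
  move=> mm nmm x [[xm nxm]|->//]; split; first exact: (wo_trans wo xm mm).
  by move=> E; rewrite E in xm; apply: nmm; exact: (wo_anti wo mm xm).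
pose Om : {pred M} := fun x => `[< exists2 m, x = b m & ~ purecl (P m) m >].
exists Om; split.
  move=> s c us sOm sum0 x xs; apply: contrapT => /eqP cx.
  have /choice[mu muP] y : exists m, y \in s -> y = b m /\ ~ purecl (P m) m.
    have [ys|] := boolP (y \in s); last by exists 0.
    by have /asboolP[m ym nm] := sOm y ys; exists m.
  (* At the largest index with a nonzero coefficient, the relation would put the new generator into
     the pure closure of earlier elements. *)
  have [|x0] := wo_max_seq wo mu (s := [seq y <- s | c y != 0]).
    by rewrite -has_filter; apply/hasP; exists x.
  rewrite mem_filter => /andP[cx0 x0s] x0max; have [x0E nx0] := muP x0 x0s.
  have := bnP _ nx0; rewrite -x0E; apply; apply: (purecl_pure cx0).
  move: sum0; rewrite (bigD1_seq x0) //= => /eqP; rewrite addr_eq0 => /eqP ->.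
  apply: submoduleN => //; rewrite big_mkcond /=; apply: submodule_sum => // y ys.
  case: eqP => [_|yx0]; first exact: (subP _).1.
  have [->|cy] := eqVneq (c y) 0; first by rewrite scale0r; exact: (subP _).1.
  apply: submoduleZ => //; have [yE ny] := muP y ys.
  have ym : le (mu y) (mu x0) by apply: x0max; rewrite mem_filter cy.
  have nym : mu y <> mu x0 by move=> E; apply: yx0; rewrite yE x0E E.
  by apply: (purecl_mono (Pm _ _ ym nym)); have := (bP (mu y)).1; rewrite -yE.
move=> z; apply: (@span_lin Om).
suff : forall m z, purecl (P m `|` [set m]) z -> span [set x | x \in Om] z.
  by move=> /(_ z z); apply; apply: purecl_self; right.
apply: (slt_ind wo) => m IH {}z zm.
have IH' y : purecl (P m) y -> span [set x | x \in Om] y.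
  move=> /purecl_finite[s sP sy]; have [s0|s0] := eqVneq s [::].
    have [r r0 [l l0]] := sy; rewrite big_seq big1 => [/tf[/eqP|->]|].
    - by rewrite (negbTE r0).
    - exact: (span_submodule _).1.
    - by move=> i /l0; rewrite /= s0.
  have [m' m's m'max] := wo_max_seq wo id s0; have [m'm m'nm] := sP m' m's.
  apply: (IH m'); first by apply: slt_neq => //; apply/eqP.
  apply: purecl_mono sy => x /= xs; have [->|/eqP xm'] := eqVneq x m'; first by right.
  by left; split=> //; apply: m'max.
have [mP|nmP] := EM (purecl (P m) m).
  by apply: IH'; move: z zm; apply: purecl_sub => x [xP|->//]; exact: purecl_self.
have [_ /(_ z zm)[r zr]] := bP m; rewrite -[z](subrK (r *: b m)).
apply: submoduleD; [exact: span_submodule|exact: IH'|apply: submoduleZ; first exact: span_submodule].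
by apply: span_self; apply/asboolP; exists m.
Qed.

Section Filtration.
Variables (le : rel M) (wo : well_order le) (unM : ~ countable [set: M]).
Hypothesis cM : forall x, countable [set y | le y x].

Definition closed_under (G : M -> M) a := forall y, slt le y a -> slt le (G y) a.

(** Iterate a bound for [G] on initial segments omega times and take the supremum, which exists
    because countable sets are bounded. *)
Lemma closed_above G x : exists2 u, closed_under G u & slt le x u.
Proof.
have /choice[h hP] x' : exists u, slt le x' u /\ forall y, le y x' -> slt le (G y) u.
  have cC : countable ([set x'] `|` [set G y | y in [set y | le y x']]).
    have -> : [set x'] `|` [set G y | y in [set y | le y x']] =
        \bigcup_(i in [set: bool]) if i then [set x'] else [set G y | y in [set y | le y x']].
      apply/predeqP => z; split=> [[zx|zG]|[[]]]; by [exists true|exists false|left|right].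
    apply: bigcup_countable => // -[] _ //; apply: sub_countable (cM x').
    exact: card_image_le.
  have [u uP] := countable_bounded unM cM cC; exists u; split.
    by apply: uP; left.
  by move=> y yx; apply: uP; right; exists y.
pose xn n := iter n h x.
have cxn : countable (range xn) by apply: sub_countable (countableP [set: nat]); exact: card_image_le.
have [u0 u0P] := countable_bounded unM cM cxn.
have [u uge umin] := wo_min wo (ex_intro (fun u => forall n, slt le (xn n) u) u0
  (fun n => u0P _ (ex_intro2 _ _ n I erefl))).
exists u; last exact: (uge 0%N).
move=> y yu; have [n ny] : exists n, le y (xn n).
  apply: contrapT => /forallNP nn; have := umin y; rewrite /slt in yu *.
  by rewrite (negbTE yu) => h'; suff : false by []; apply: h' => n; apply/negP/nn.
exact (slt_le_trans wo ((hP (xn n)).2 y ny) (sltW wo (uge n.+1))).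
Qed.

(** Elements are grouped by the last closed point [st m] below them, and each countable group is
    ordered in type at most omega. An initial segment is then the part below a closed point together
    with a finite list, where the hypothesis makes [cyclic_step] applicable. *)
Lemma free_of_filtration (G : M -> M) :
  (forall a, closed_under G a -> ~ not_aleph1_free_mod [set y | slt le y a]) -> is_free M.
Proof.
move=> Ggood.
have /choice[st stP] m : exists a, [/\ closed_under G a, le a m &
    forall a', closed_under G a' -> le a' m -> le a' a].
  (* A supremum of closed points is closed, so the least upper bound of those below [m] is the
     greatest of them. If there were none, it would be the least element, which is closed
     vacuously. *)
  have [a aub amin] := wo_min wo (ex_intro
    (fun a => forall a', closed_under G a' -> le a' m -> le a' a) m (fun _ _ => id)).
  exists a; split=> //; last by apply: amin.
  move=> y ya; have [a' [ca' a'm ya']] : exists a', [/\ closed_under G a', le a' m & slt le y a'].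
    apply: contrapT => ne; have := amin y; rewrite /slt in ya; rewrite (negbTE ya) => h.
    suff : false by []; apply: h => a' ca' a'm; apply: contrapT => /negP na'.
    by apply: ne; exists a'.
  exact: slt_le_trans (ca' y ya') (aub a' ca' a'm).
have fib x : countable [set m | st m = x].
  have [u cu xu] := closed_above G x; apply: sub_countable (cM u).
  apply: subset_card_le => m /= mx; apply: (sltW wo); rewrite /slt; apply/negP => um.
  have [_ _ /(_ u cu um)] := stP m; rewrite mx => ux.
  by move: xu; rewrite /slt ux.
have [le' [wo' _ le'P]] := lexicographic wo fib.
have stE m m' : slt le (st m') (st m) <-> slt le m' (st m).
  have [cm lem maxm] := stP m; have [cm' lem' maxm'] := stP m'.
  split=> [lt|]; last exact: le_slt_trans.
  by apply/negP => /(maxm' _ cm); move: lt; rewrite /slt => /negP.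
apply: (free_of_cyclic_steps wo') => m; have [s sP] := le'P m.
have -> : [set x | le' x m /\ x <> m] = [set y | slt le y (st m)] `|` [set` s].
  by apply/predeqP => x; split=> [/sP[/stE|]|[/stE|] xs]; by [left|right|apply/sP; left|apply/sP; right].
set W := _ `|` [set` s].
have [||p x pp nWx|b bW bE] := @cyclic_step R R_PID M R_fin_primes (purecl W) m.
- exact: purecl_submodule.
- exact: purecl_pure.
- apply: contrapT => /forallNP nd; have [cm _ _] := stP m.
  apply: (Ggood _ cm); exists p, s, x; split=> [//||n]; first exact: nWx.
  by apply: contrapT => nz; apply: (nd n) => z zW; apply: nz; exists z.
have clE : purecl (purecl W `|` [set m]) = purecl (W `|` [set m]).
  apply/predeqP => z; split.
    apply: purecl_sub => x [|->]; last by apply: purecl_self; right.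
    by apply: purecl_mono; left.
  by apply: purecl_mono => x [Wx|->]; [left; exact: purecl_self | right].
by rewrite -clE; exists b.
Qed.

End Filtration.
End Freeness.

(** * Extending linear maps *)

Section Extension.
Variables (R : idomainType) (M : lmodType R).
Variables (K : fieldType) (emb : {rmorphism R -> K}).
Hypothesis emb_inj : injective emb.
Local Notation "x %:F" := (emb x).
Local Notation Klinear := (Klinear emb).
Implicit Types (u v w : nat -> K).

(** Graphs of linear maps from a submodule of [M] to sequences in [K]; given linearity, the last
    clause is single-valuedness. *)
Definition linear_graph (G : set (M * (nat -> K))) : Prop :=
  [/\ G (0, fun=> 0), forall r x y u v, G (x, u) -> G (y, v) ->
        G (r *: x + y, fun n => r%:F * u n + v n) & forall v, G (0, v) -> v = fun=> 0].

(** [V] is divisible, hence a maximal partial map is total: if a nonzero multiple of [m] is in the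
    domain, its value is divided; otherwise [0] is a possible value at [m]. *)
Lemma linear_graph_extend (V : set (nat -> K)) (G0 : set (M * (nat -> K))) :
  V (fun=> 0) -> (forall r u v, V u -> V v -> V (fun n => r%:F * u n + v n)) ->
  (forall r u, r != 0 -> V u -> V (fun n => u n / r%:F)) ->
  linear_graph G0 -> (forall x v, G0 (x, v) -> V v) ->
  exists F : M -> nat -> K, [/\ forall n, Klinear (F^~ n), forall x v, G0 (x, v) -> F x = v &
    forall x, V (F x)].
Proof.
move=> V0 Vlin Vdiv G0l G0V.
pose good G := [/\ linear_graph G, G0 `<=` G & forall x v, G (x, v) -> V v].
have good0 : good G0 by split.
pose P G := G = set0 \/ good G.
have [C CP Ctot|G [GP Gmax]] := @Zorn_bigcup _ P.
  have [[G1 [G1C G1n]]|allE] := EM (exists G, C G /\ G <> set0); last first.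
    left; apply/predeqP => x; split=> // -[G CG Gx].
    by apply: allE; exists G; split=> // G0E; rewrite G0E in Gx.
  right; have goodC G : C G -> G <> set0 -> good G by move=> /CP[->|].
  have [[G10 _ _] G01 _] := goodC G1 G1C G1n.
  have ne (G : set (M * (nat -> K))) y : G y -> G <> set0 by move=> Gy GE; rewrite GE in Gy.
  split; last 2 first.
  - by move=> x /G01 G1x; exists G1.
  - by move=> x v [G CG Gx]; have [_ _] := goodC G CG (ne _ _ Gx); apply; exact: Gx.
  split; first by exists G1.
    move=> r x y u v [G CG Gx] [H CH Hy].
    have [[_ GL _] _ _] := goodC G CG (ne _ _ Gx); have [[_ HL _] _ _] := goodC H CH (ne _ _ Hy).
    have [GH|HG] := Ctot G H CG CH.
      by exists H => //; apply: HL => //; exact: GH.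
    by exists G => //; apply: GL => //; exact: HG.
  by move=> v [G CG Gv]; have [[_ _ +] _ _] := goodC G CG (ne _ _ Gv); apply.
have Gn0 : G <> set0.
  move=> GE; apply: (Gmax G0); last by right.
  have [G00 _ _] := G0l; split; first by rewrite GE.
  by rewrite GE => /(_ _ G00).
have [|[[G00 GL Gfun] G0G GV]] := GP; first by [].
have uniqG x u v : G (x, u) -> G (x, v) -> u = v.
  move=> Gu Gv; have := Gfun _ (_ : G (0, fun n => (-1)%:F * u n + v n)).
  move=> E; apply/funext => n; have := GL (-1) x x u v Gu Gv.
  rewrite scaleN1r addNr => /E/(congr1 (@^~ n))/eqP; rewrite rmorphN rmorph1 mulN1r addrC subr_eq0.
  by move=> /eqP ->.
have GZ r x u : G (x, u) -> G (r *: x, fun n => r%:F * u n).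
  move=> Gx; have := GL r x 0 u _ Gx G00; rewrite addr0; congr G; congr (_, _).
  by apply/funext => n; rewrite addr0.
have total m : exists u, G (m, u).
  apply: contrapT => nm.
  have [w [Vw wP]] : exists w, V w /\ forall x v t, G (x, v) -> x + t *: m = 0 ->
      forall n, v n + t%:F * w n = 0.
    have [[r [u [r0 Gu]]]|nr] := EM (exists r u, r != 0 /\ G (r *: m, u)).
      exists (fun n => u n / r%:F); split; first by apply: Vdiv => //; exact: GV Gu.
      move=> x v t Gx xt n; have := GL r x (t *: (r *: m)) _ _ Gx (GZ t _ _ Gu).
      rewrite scalerA [t * r]mulrC -scalerA -scalerDr xt scaler0 => /Gfun/(congr1 (@^~ n)) E.
      have r0' : r%:F != 0 by rewrite -(rmorph0 emb) (inj_eq emb_inj).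
      by apply: (mulfI r0'); rewrite mulr0 -E; field.
    exists (fun=> 0); split=> // x v t Gx xt n; have [t0|t0] := eqVneq t 0.
      move: xt Gx; rewrite t0 scale0r addr0 => -> /Gfun ->.
      by rewrite mulr0 addr0.
    case: nr; exists (- t), v; rewrite oppr_eq0; split=> //.
    by rewrite scaleNr; move/eqP: xt; rewrite addr_eq0 => /eqP <-.
  pose H : set (M * (nat -> K)) := [set y | exists x v t, [/\ G (x, v), y.1 = x + t *: m &
    y.2 = fun n => v n + t%:F * w n]].
  have GH : G `<=` H.
    move=> [x v] Gx; exists x, v, 0; split=> //=; first by rewrite scale0r addr0.
    by apply/funext => n; rewrite rmorph0 mul0r addr0.
  apply: (Gmax H).
    split=> // HG; apply: nm; exists w; apply: HG; exists 0, (fun=> 0), 1; split=> //=.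
      by rewrite scale1r add0r.
    by apply/funext => n; rewrite rmorph1 mul1r add0r.
  right; split; [split; first exact: GH | by move=> x /G0G/GH |].
  - move=> r y y' w1 w2 [x [v [t [Gx /= -> ->]]]] [x' [v' [t' [Gx' /= -> ->]]]].
    exists (r *: x + x'), (fun n => r%:F * v n + v' n), (r * t + t'); split=> /=.
    + exact: GL.
    + by rewrite scalerDr addrACA scalerA scalerDl.
    + by apply/funext => n; rewrite rmorphD rmorphM /=; ring.
  - move=> v1 [x [v [t [Gx /= /esym xt ->]]]]; apply/funext => n.
    exact: wP xt n.
  - move=> y v1 [x [v [t [Gx /= yE ->]]]].
    have := Vlin t w v Vw (GV _ _ Gx); congr V; apply/funext => n; exact: addrC.
have /choice[F FP] := total; exists F; split.
- move=> n r x y; have := uniqG _ _ _ (FP (r *: x + y)) (GL r x y _ _ (FP x) (FP y)).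
  by move=> ->.
- by move=> x v /G0G Gx; exact: uniqG (FP x) Gx.
- by move=> x; exact: GV (FP x).
Qed.

End Extension.

(* The families [wx b], [wxs b], each independent modulo [I b], are stacked along the well-order,
   hence jointly independent. *)
Section StackedFamilies.
Variables (R : idomainType) (M : lmodType R) (le : rel M) (wo : well_order le).
Variables (K : fieldType) (emb : {rmorphism R -> K}).
Hypothesis emb_inj : injective emb.
Local Notation "x %:F" := (emb x).
Local Notation I b := [set y | slt le y b].
Variables (B : set M) (wx : M -> M) (wxs : M -> seq M).
Hypothesis I_submodule : forall b, B b -> submodule (I b).
Hypothesis stacked : forall b b', B b -> B b' -> slt le b' b ->
  I b (wx b') /\ forall x, x \in wxs b' -> I b x.
Hypothesis independent : forall b, B b -> forall (c0 : R) (c : nat -> R),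
  I b (c0 *: wx b + lcomb (wxs b) c) -> c0 = 0 /\ forall i, (i < size (wxs b))%N -> c i = 0.

Let term (c : M -> R) (d : M -> nat -> R) b := c b *: wx b + lcomb (wxs b) (d b).

(** All terms but the one of largest index [b0] lie in [I b0]. Hence so does that one, and its
    coefficients vanish by independence modulo [I b0]. *)
Lemma stacked_independent (l : seq M) c d : uniq l -> (forall b, b \in l -> B b) ->
  \sum_(b <- l) term c d b = 0 -> forall b, b \in l -> c b = 0.
Proof.
move: {2}(size l) (erefl (size l)) => n; elim: n l => [|n IH] l szl ul lB sum0 b bl.
  by move: bl; rewrite (size0nil szl).
have [|b0 b0l b0max] := wo_max_seq wo id (s := l); first by rewrite -size_eq0 szl.
move: sum0; rewrite (big_rem b0) //= => sum0.
have subI := I_submodule (lB _ b0l).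
have b0I : I b0 (term c d b0).
  move/eqP: sum0; rewrite addr_eq0 => /eqP ->; apply: submoduleN => //.
  apply: submodule_sum => // b'; rewrite mem_rem_uniq // inE => /andP[b'b0 b'l].
  have [xI xsI] := stacked (lB _ b0l) (lB _ b'l) (slt_neq wo (b0max _ b'l) b'b0).
  by apply: submoduleD => //; [apply: submoduleZ | apply: lcomb_sub].
have [c0 d0] := independent (lB _ b0l) b0I.
have [->//|bb0] := eqVneq b b0; apply: (IH (rem b0 l)).
- by rewrite size_rem // szl.
- exact: rem_uniq.
- by move=> b' /mem_rem; exact: lB.
- move: sum0; rewrite /term c0 scale0r add0r /lcomb big1 ?add0r // => i _.
  by rewrite d0 ?scale0r.
- by rewrite mem_rem_uniq // inE bb0.
Qed.

(** Joint independence makes the prescription well defined on the span of the families, and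
    divisibility of [V] extends it to [M]. *)
Lemma stacked_extend (V : set (nat -> K)) (v : M -> nat -> K) :
  V (fun=> 0) -> (forall r u v, V u -> V v -> V (fun n => r%:F * u n + v n)) ->
  (forall r u, r != 0 -> V u -> V (fun n => u n / r%:F)) ->
  (forall b, B b -> V (v b)) ->
  exists F : M -> nat -> K, [/\ forall n, Klinear emb (F^~ n), forall b, B b -> F (wx b) = v b,
    forall b x, B b -> x \in wxs b -> F x = fun=> 0 & forall x, V (F x)].
Proof.
move=> V0 Vlin Vdiv Vv.
pose val c l n := \sum_(b <- l) (c b)%:F * v b n.
pose G0 : set (M * (nat -> K)) := [set y | exists (l : seq M) c d,
  [/\ uniq l, forall b, b \in l -> B b, forall b, b \notin l -> c b = 0 /\ d b = fun=> 0 &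
      y = (\sum_(b <- l) term c d b, val c l)]].
have term0 c d b : c b = 0 /\ d b = (fun=> 0) -> term c d b = 0.
  by move=> [c0 d0]; rewrite /term c0 d0 scale0r add0r /lcomb big1 // => i _; rewrite scale0r.
have [|x u|F [FL FG FV]] := linear_graph_extend emb_inj V0 Vlin Vdiv (G0 := G0).
- split.
  + exists [::], (fun=> 0), (fun _ => fun=> 0); split=> //.
    by rewrite big_nil /val; congr (_, _); apply/funext => n; rewrite big_nil.
  + move=> r x y u u' [l [c [d [ul lB l0 [-> ->]]]]] [l' [c' [d' [ul' lB' l0' [-> ->]]]]].
    pose k := undup (l ++ l'); have uk : uniq k by exact: undup_uniq.
    have lk : {subset l <= k} by move=> b bl; rewrite mem_undup mem_cat bl.
    have lk' : {subset l' <= k} by move=> b bl; rewrite mem_undup mem_cat bl orbT.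
    exists k, (fun b => r * c b + c' b), (fun b i => r * d b i + d' b i); split=> //.
    * by move=> b; rewrite mem_undup mem_cat => /orP[/lB|/lB'].
    * move=> b; rewrite mem_undup mem_cat negb_or => /andP[/l0[-> ->] /l0'[-> ->]].
      by rewrite mulr0 addr0; split=> //; apply/funext => i; rewrite mulr0 addr0.
    congr (_, _).
      rewrite -(sum_sub ul uk lk) => [|b /l0/term0 //].
      rewrite -(sum_sub ul' uk lk') => [|b /l0'/term0 //].
      rewrite scaler_sumr -big_split; apply: eq_bigr => b _.
      by rewrite /term /= scalerDr lcombZ addrACA lcombD scalerA scalerDl.
    apply/funext => n; rewrite /val.
    have ext l1 (c1 : M -> R) : uniq l1 -> {subset l1 <= k} ->
        (forall b, b \notin l1 -> c1 b = 0) ->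
        \sum_(b <- l1) (c1 b)%:F * v b n = \sum_(b <- k) (c1 b)%:F * v b n.
      move=> ul1 l1k c10; apply/esym; apply: (@sum_sub K _ K^o) => // b /c10 ->.
      by rewrite rmorph0 mul0r.
    rewrite (ext l c) // => [|b /l0[]//]; rewrite (ext l' c') // => [|b /l0'[]//].
    rewrite mulr_sumr -big_split; apply: eq_bigr => b _.
    by rewrite rmorphD rmorphM /=; ring.
  + move=> u [l [c [d [ul lB l0 [/esym sum0 ->]]]]]; apply/funext => n.
    have c0 := stacked_independent ul lB sum0.
    by rewrite /val big_seq big1 // => b /c0 ->; rewrite rmorph0 mul0r.
- move=> [l [c [d [ul lB l0 [_ ->]]]]].
  elim: l lB {ul l0} => [|b l IH] lB; rewrite /val.
    by have := V0; congr V; apply/funext => n; rewrite big_nil.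
  have := Vlin (c b) _ _ (Vv b (lB b (mem_head _ _))) (IH (fun b' b'l => lB b' (mem_behead (s := b :: l) b'l))).
  by congr V; apply/funext => n; rewrite big_cons.
exists F; split=> // [b Bb|b x Bb xb].
- apply: FG; exists [:: b], (fun b' => (b' == b)%:R), (fun _ => fun=> 0); split=> //.
  + by move=> b'; rewrite inE => /eqP ->.
  + by move=> b'; rewrite inE => /negbTE ->.
  + rewrite big_seq1 /term eqxx scale1r /lcomb big1 ?addr0; last by move=> i _; rewrite scale0r.
    by congr (_, _); apply/funext => n; rewrite /val big_seq1 eqxx rmorph1 mul1r.
- have ix : (index x (wxs b) < size (wxs b))%N by rewrite index_mem.
  apply: FG; exists [:: b], (fun=> 0), (fun b' i => ((b' == b) && (i == index x (wxs b)))%:R); split=> //.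
  + by move=> b'; rewrite inE => /eqP ->.
  + by move=> b'; rewrite inE => /negbTE ->.
  + rewrite big_seq1 /term eqxx scale0r add0r /lcomb (bigD1 (Ordinal ix)) //= eqxx scale1r.
    rewrite nth_index // big1 ?addr0; last first.
      by move=> i /negbTE; rewrite -val_eqE /= => ->; rewrite scale0r.
    by congr (_, _); apply/funext => n; rewrite /val big_seq1 rmorph0 mul0r.
Qed.

End StackedFamilies.

(** * Uniformization *)

Section Uniformization.
Variables (R : idomainType) (R_PID : is_PID R).
Variables (K : fieldType) (emb : {rmorphism R -> K}).
Hypothesis emb_inj : injective emb.
Hypothesis emb_frac : forall q : K, exists a b, b != 0 /\ q = emb a / emb b.
Variables (code : K -> nat) (code_inj : injective code).
Local Notation "x %:F" := (emb x).
Local Notation local := (local emb).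
Variables (M : lmodType R) (hsM : hereditarily_separable M) (le : rel M) (wo : well_order le).
Local Notation I b := [set y | slt le y b].
Variables (B : set M) (p : R) (wx : M -> M) (wxs : M -> seq M) (wz ws : M -> nat -> M).
Variables (wu : M -> nat -> nat -> R) (enum : M -> nat -> M).
Hypothesis I_submodule : forall b, B b -> submodule (I b).
Hypothesis stacked : forall b b', B b -> B b' -> slt le b' b ->
  I b (wx b') /\ forall x, x \in wxs b' -> I b x.
Hypothesis wit : forall b, B b -> witness (I b) p (wxs b) (wx b) (wz b) (ws b) (wu b).
Hypothesis pp : prime_element p.

Definition label : Type := (M * M * seq R)%type.

(* Only data lying in [I b] or in the countable ring are recorded, together with an
   enumeration of [I b], which makes [branch] injective on [B]. *)
Definition branch b n : label :=
  (enum b n, ws b n.+1, mkseq (wu b n.+1) (size (wxs b))).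

Definition node b n := mkseq (branch b) n.

Lemma node_eq b b' n i : node b n = node b' n -> (i < n)%N -> branch b i = branch b' i.
Proof.
move=> E lin; have d : label := branch b 0%N.
by have := congr1 (fun s => nth d s i) E; rewrite /node !nth_mkseq.
Qed.

Lemma branch_wit b b' i : branch b i = branch b' i ->
  [/\ ws b i.+1 = ws b' i.+1, size (wxs b) = size (wxs b') &
      forall j, (j < size (wxs b))%N -> wu b i.+1 j = wu b' i.+1 j].
Proof.
move=> [_ sE uE]; have szE : size (wxs b) = size (wxs b').
  by have := congr1 size uE; rewrite !size_mkseq.
split=> // j jb; have := congr1 (fun s => nth 0 s j) uE.
by rewrite /= !nth_mkseq // -szE.
Qed.

Lemma node_size b b' n : (0 < n)%N -> node b n = node b' n -> size (wxs b) = size (wxs b').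
Proof. by move=> n0 /node_eq/(_ n0)/branch_wit[]. Qed.

Section LinearForm.
Variables (g : M -> K) (gL : Klinear emb g).

Definition values b : K * seq K := (g (wx b), map g (wxs b)).

Lemma Klinear_lcomb xs c : g (lcomb xs c) = \sum_(i < size xs) (c i)%:F * (map g xs)`_i.
Proof.
rewrite (Klinear_sum gL); apply: eq_bigr => i _; rewrite (KlinearZ gL).
by rewrite (nth_map 0).
Qed.

Lemma Klinear_quotient b n : B b -> p%:F ^+ n * g (wz b n) =
  (values b).1 + \sum_(i < size (wxs b)) (wu b n i)%:F * (values b).2`_i - g (ws b n).
Proof.
move=> Bb; have [_ zE _ _] := wit Bb; have [_ E] := zE n.
by rewrite -rmorphXn -(KlinearZ gL) E (KlinearB gL) (KlinearD gL) Klinear_lcomb.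
Qed.

(** [g (wz b n)] is determined by [values b] and the data of level [n]. These are entry [n - 1] of
    the branch, whence the condition [0 < n]. *)
Lemma Klinear_quotient_eq b b' n : B b -> B b' -> (0 < n)%N -> node b n = node b' n ->
  values b = values b' -> g (wz b n) = g (wz b' n).
Proof.
move=> Bb Bb' n0 nE vE; have p0 : p%:F != 0 by rewrite (emb_eq0 emb_inj); case: pp.
apply: (mulfI (expf_neq0 n p0)); rewrite !Klinear_quotient // vE.
case: n n0 nE => // n _ /node_eq/(_ (leqnn _))/branch_wit[-> szE uE].
congr (_ + _ - _); rewrite szE; apply: eq_bigr => i _; rewrite uE // szE.
by case: i.
Qed.

(** A test for a candidate [v] for [values b]: the values it forces on the [wz b i] with
    [0 < i <= n] must lie in [R_p]. Only data recorded on the branch enter. *)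
Definition consistent b n (v : K * seq K) : Prop := size v.2 = size (wxs b) /\
  forall i, (i < n)%N -> local p
    ((v.1 + \sum_(j < size (wxs b)) (wu b i.+1 j)%:F * v.2`_j - g (ws b i.+1)) / p%:F ^+ i.+1).

Hypothesis g_local : forall m, local p (g m).

Lemma consistent_values b n : B b -> consistent b n (values b).
Proof.
move=> Bb; split; first by rewrite size_map.
move=> i _; rewrite -Klinear_quotient // mulrC mulKf // expf_neq0 //.
by rewrite (emb_eq0 emb_inj); case: pp.
Qed.

Lemma consistent_node b b' n v : node b n = node b' n -> (0 < n)%N ->
  consistent b' n v -> consistent b n v.
Proof.
move=> nE n0 [sz con]; have szE := node_size n0 nE; split; first by rewrite szE.
move=> i lin; have [sE _ uE] := branch_wit (node_eq nE lin).
have := con i lin; rewrite sE -szE; congr (local p ((_ + _ - _) / _)).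
by apply: eq_bigr => j _; rewrite uE.
Qed.

Lemma consistentW b m n v : (m <= n)%N -> consistent b n v -> consistent b m v.
Proof. by move=> mn [sz con]; split=> // i im; apply: con; apply: leq_trans mn. Qed.

Lemma common_denominator (f : nat -> K) k : (forall j, (j < k)%N -> local p (f j)) ->
  exists e (m : nat -> R), ~ divides p e /\ forall j, (j < k)%N -> f j * e%:F = (m j)%:F.
Proof.
elim: k => [_|k IH fl].
  exists 1, (fun=> 0); split=> // -[c c1]; case: pp => _ /negP pU _; apply: pU.
  by apply: (@divides_unit _ p 1); [exists c | exact: unitr1].
have [|e [m [pe mE]]] := IH; first by move=> j jk; apply: fl; apply: leqW.
have [a [b [pb E]]] := fl k (ltnSn k).
exists (e * b), (fun j => if j == k then a * e else m j * b).
split; first exact: prime_not_divides_mul.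
move=> j; rewrite ltnS leq_eqVlt; case: eqP => [-> _|_ /= jk].
  by rewrite !rmorphM /= -E; ring.
by rewrite !rmorphM /= -mE //; ring.
Qed.

(** If a wrong candidate passed all tests, its difference from [values b], cleared of denominators
    prime to [p], would be a linear form excluded by the last clause of [witness]. *)
Lemma consistent_uniq b b' : B b -> B b' -> values b' <> values b ->
  exists n, ~ consistent b n (values b').
Proof.
move=> Bb Bb' neq; apply: contrapT => /forallNP ncon; apply: neq.
have con n : consistent b n (values b') by apply: contrapT; exact: ncon.
have [_ _ _ uniq0] := wit Bb; have [sz _] := con 0%N.
pose k := size (wxs b); pose mu j := (values b').2`_j - (values b).2`_j.
pose mu0 := (values b').1 - (values b).1.
pose f j := if j is j'.+1 then mu j' else mu0.
have szb : size (values b).2 = k by rewrite size_map.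
have nth_local b1 j : local p (values b1).2`_j.
  have [jb|jb] := ltnP j (size (wxs b1)); first by rewrite (nth_map 0).
  by rewrite nth_default ?size_map //; have := local_int emb pp 0; rewrite rmorph0.
have [|e [m [pe mE]]] := @common_denominator f k.+1.
  by case=> [|j] _; apply: localB => //; exact: g_local.
have e0 := not_divides_neq0 emb_inj pe.
have [|m00 mj0] := uniq0 (m 0%N) (fun j => m j.+1).
  move=> n; apply/(local_div_exp emb_inj pp).
  have [_ /(_ n (ltnSn n)) c1] := con n.+1.
  have [_ /(_ n (ltnSn n)) c2] := consistent_values n.+1 Bb.
  have := localM pp (local_int emb pp e) (localB pp c1 c2); congr (local p).
  rewrite rmorphD rmorph_sum /= -mE // -mulrBl mulrA; congr (_ / _).
  have -> : forall x y z x' y', x + y - z - (x' + y' - z) = (x - x') + (y - y') :> K.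
    by move=> x y z x' y'; ring.
  rewrite mulrDr [e%:F * _]mulrC; congr (_ + _).
  rewrite -sumrB mulr_sumr; apply: eq_bigr => j _.
  by rewrite rmorphM /= -mE ?ltnS // -mulrBr mulrCA [e%:F * _]mulrC.
have f0 j : (j < k.+1)%N -> f j = 0.
  move=> jk; apply: (mulIf e0); rewrite mE // mul0r; case: j jk => [|j] jk; first by rewrite m00 rmorph0.
  by rewrite mj0 ?rmorph0.
have v1E : (values b').1 = (values b).1.
  by have := f0 0%N isT => /eqP; rewrite subr_eq0 => /eqP.
have v2E : (values b').2 = (values b).2.
  apply: (@eq_from_nth _ 0); first by rewrite sz szb.
  by move=> j; rewrite sz => jk; have := f0 j.+1 jk => /eqP; rewrite subr_eq0 => /eqP.
by move: v1E v2E; rewrite /values /= => -> ->.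
Qed.

Definition values_code (v : K * seq K) : nat := pickle (code v.1, map code v.2).

Lemma values_code_inj : injective values_code.
Proof.
move=> [x s] [y t] /(pcan_inj pickleK)[/code_inj -> /(inj_map code_inj) ->].
by [].
Qed.

(* The value [values b] is eventually the candidate of least code which is consistent with
   the data read along the branch. *)
Lemma values_uniformized : exists f : M -> nat, forall b b' n, B b -> B b' ->
  (f b <= n)%N -> (f b' <= n)%N -> node b n = node b' n -> values b = values b'.
Proof.
pose N b := values_code (values b).
have /choice[f fP] b : exists m, (0 < m)%N /\ (B b -> forall b', B b' -> (N b' < N b)%N ->
    ~ consistent b m (values b')).
  have [Bb|] := EM (B b); last by exists 1%N.
  suff [m mP] : exists m, forall b', B b' -> (N b' < N b)%N -> ~ consistent b m (values b').
    exists m.+1; split=> // _ b' Bb' /(mP b' Bb') nc; apply: contra_not nc.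
    exact/consistentW/leqnSn.
  (* Only finitely many codes are smaller than that of [values b]; the maximum of the levels
     refuting them is taken. *)
  elim: {1 3}(N b) (leqnn (N b)) => [_|k IH kN]; first by exists 0%N.
  have [m mP] := IH (ltnW kN).
  have [[b1 [Bb1 N1]]|nb1] := EM (exists b1, B b1 /\ N b1 = k); last first.
    exists m => b' Bb'; rewrite ltnS leq_eqVlt => /orP[/eqP E|]; last exact: mP.
    by case: nb1; exists b'.
  have [|m1 m1P] := consistent_uniq Bb Bb1.
    by move=> E; move: kN; rewrite -N1 /N E ltnn.
  exists (maxn m m1) => b' Bb'; rewrite ltnS leq_eqVlt => /orP[/eqP E|kb'].
    have -> : values b' = values b1 by apply: values_code_inj; rewrite -/(N b') -/(N b1) E N1.
    by apply: contra_not m1P; apply/consistentW/leq_maxr.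
  by apply: contra_not (mP b' Bb' kb'); apply/consistentW/leq_maxl.
have half b b' n : B b -> B b' -> (f b <= n)%N -> node b n = node b' n -> ~ (N b' < N b)%N.
  move=> Bb Bb' fb nE Nlt; have [f0 /(_ Bb b' Bb' Nlt)] := fP b; apply.
  apply: (consistentW fb); apply: consistent_node nE _ _; first exact: leq_trans fb.
  exact: consistent_values.
exists f => b b' n Bb Bb' fb fb' nE; apply: values_code_inj.
have := half b b' n Bb Bb' fb nE; have := half b' b n Bb' Bb fb' (esym nE).
by rewrite -/(N b) -/(N b'); case: ltngtP.
Qed.

End LinearForm.

Lemma stacked_form (V : set (nat -> K)) (v : M -> nat -> K) :
  V (fun=> 0) -> (forall r u v, V u -> V v -> V (fun n => r%:F * u n + v n)) ->
  (forall r u, r != 0 -> V u -> V (fun n => u n / r%:F)) ->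
  (forall b, B b -> V (v b)) ->
  exists F : M -> nat -> K, [/\ forall n, Klinear emb (F^~ n), forall b, B b -> F (wx b) = v b,
    forall b x, B b -> x \in wxs b -> F x = fun=> 0 & forall x, V (F x)].
Proof.
apply: (stacked_extend wo emb_inj I_submodule stacked) => b Bb c0 c.
by have [_ _ ind _] := wit Bb; exact: ind.
Qed.

(** * Prediction of colours by a second prime, and of p-adic integers *)

Section Monochromatic.
Variables (q : R) (pq : prime_element q) (npq : ~ divides p q).

Lemma inv_pow_local_inj k k' :
  local q ((q%:F ^+ k)^-1 - (q%:F ^+ k')^-1) -> k = k'.
Proof.
have q0 : q%:F != 0 by rewrite (emb_eq0 emb_inj); case: pq.
wlog kk' : k k' / (k < k')%N.
  move=> H l; have [kk|kk|//] := ltngtP k k'; first exact: H.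
  by apply/esym/H => //; exact: localB_sym.
have -> : (q%:F ^+ k)^-1 - (q%:F ^+ k')^-1 = (q ^+ (k' - k) - 1)%:F / q%:F ^+ k'.
  rewrite rmorphB rmorph1 rmorphXn mulrBl mul1r; congr (_ - _).
  by rewrite -{2}(subnK (ltnW kk')) exprD invfM mulrA mulfV ?mul1r ?expf_neq0.
move=> /(local_div_exp emb_inj pq) qd.
have d1 : divides q (q ^+ (k' - k)) by rewrite -{1}[q]expr1; apply: divides_exp; rewrite subn_gt0.
have d2 : divides q (q ^+ (k' - k) - 1).
  by apply: divides_trans qd; rewrite -{1}[q]expr1; apply: divides_exp; apply: leq_ltn_trans kk'.
case: pq => _ /negP qU _; case: qU; apply: (@divides_unit _ q 1); last exact: unitr1.
by have := dividesD d1 (dividesN d2); rewrite opprB addrC subrK.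
Qed.

(** The colour of [b] is encoded as the class of [q ^ (- kappa b)] in [K / R_q], attached to [wx b].
    The lift [g] takes values in [R[1/q]], hence in [R_p], so [values_uniformized] predicts
    [g (wx b)]; as [g] and the encoding have the same kernel modulo [R_q], this determines the
    colour. *)
Lemma monochromatic_uniformization (kappa : M -> nat) : exists f : M -> nat,
  forall b b' n, B b -> B b' -> (f b <= n)%N -> (f b' <= n)%N -> node b n = node b' n ->
  kappa b = kappa b'.
Proof.
have [|||b _|F [FL Fx _ _]] :=
  @stacked_form setT (fun b _ => (q%:F ^+ kappa b)^-1); try by [].
have FL0 := FL 0%N.
have lq0 : local q 0 by have := local_int emb pq 0; rewrite rmorph0.
have [|g [gL gloc gint]] := local_lift R_PID emb_inj emb_frac hsM pq (phi := F^~ 0%N).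
  by move=> r x y; rewrite FL0 subrr.
have gp m : local p (g m).
  have [e qe] := pow_local_ex R_PID emb_inj emb_frac (F m 0%N) pq.
  have [|r rE] := gint (q ^+ e *: m); first by rewrite (KlinearZ FL0) rmorphXn.
  have qe0 : q%:F ^+ e != 0 by rewrite expf_neq0 // (emb_eq0 emb_inj); case: pq.
  have -> : g m = r%:F * ((q ^+ e)%:F)^-1.
    by apply: (mulfI qe0); rewrite -rE (KlinearZ gL) rmorphXn; field.
  apply: localM => //; first exact: local_int.
  by apply: local_inv => //; apply: prime_not_divides_exp.
have [f fP] := values_uniformized gL gp; exists f => b b' n Bb Bb' fb fb' nE.
have [vE _] := fP b b' n Bb Bb' fb fb' nE.
have : local q (F (wx b - wx b') 0%N).
  by apply/gloc; rewrite (KlinearB gL) vE subrr.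
by rewrite (KlinearB FL0) !Fx //; exact: inv_pow_local_inj.
Qed.

Lemma uniformization (c : M -> nat -> R) : exists f : M -> nat,
  forall b b' n, B b -> B b' -> (f b <= n)%N -> (f b' <= n)%N -> node b n = node b' n ->
  divides (p ^+ n) (\sum_(i < n) p ^+ i * c b i - \sum_(i < n) p ^+ i * c b' i).
Proof.
pose sig b n := \sum_(i < n) p ^+ i * c b i.
(* Sequences that converge p-adically at the rate [p ^+ n], up to one common denominator [r]. They
   form a divisible module, as the extension requires, and contain the partial sums [sig b]. *)
pose V : set (nat -> K) := [set v | exists2 r, r != 0 &
  forall n, exists t, r%:F * (v n.+1 - v n) = (p ^+ n * t)%:F].
have p0 : p%:F != 0 by rewrite (emb_eq0 emb_inj); case: pp.
have [|r u v|r u r0|b _|F [FL Fx Fxs FV]] := @stacked_form V (fun b n => (sig b n)%:F).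
- exists 1; rewrite ?oner_eq0 // => n; exists 0.
  by rewrite subrr !mulr0 rmorph0.
- move=> [a a0 aP] [d d0 dP]; exists (a * d); first by rewrite mulf_neq0.
  move=> n; have [t tE] := aP n; have [t' t'E] := dP n.
  exists (r * d * t + a * t').
  have -> : p ^+ n * (r * d * t + a * t') = (r * d) * (p ^+ n * t) + a * (p ^+ n * t') by ring.
  by rewrite rmorphD [X in _ = X + _]rmorphM [X in _ = _ + X]rmorphM /= -tE -t'E !rmorphM /=; ring.
- move=> [a a0 aP]; exists (a * r); first by rewrite mulf_neq0.
  move=> n; have [t tE] := aP n; exists t; rewrite -tE rmorphM /=.
  have r0' : r%:F != 0 by rewrite (emb_eq0 emb_inj).
  by field.
- exists 1; rewrite ?oner_eq0 // => n; exists (c b n).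
  by rewrite rmorph1 mul1r -rmorphB /sig big_ord_recr /= addrAC subrr add0r.
(* From the exponent of [p] in the denominator on, the terms are constant modulo [R_p]; [phi] is
   this limit in [K / R_p]. *)
have /choice[nu nuP] m : exists n0, forall n, (n0 <= n)%N -> local p (F m n - F m n0).
  have [r r0 rE] := FV m; have [e [r' r'E pr']] := prime_exact R_PID pp r0.
  have r'0 := not_divides_neq0 emb_inj pr'.
  exists e; elim=> [|n IH]; first by rewrite leqn0 => /eqP ->; have := local_int emb pp 0; rewrite rmorph0 subrr.
  rewrite leq_eqVlt => /orP[/eqP <-|].
    by have := local_int emb pp 0; rewrite rmorph0 subrr.
  rewrite ltnS => en; rewrite -[F m n.+1](subrK (F m n)) -addrA; apply: localD => //; last exact: IH.
  have [t tE] := rE n; exists (p ^+ (n - e) * t), r'; split=> //.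
  apply: (mulfI (expf_neq0 e p0)).
  have -> : p%:F ^+ e * ((F m n.+1 - F m n) * r'%:F) = r%:F * (F m n.+1 - F m n).
    by rewrite r'E rmorphM rmorphXn /=; ring.
  by rewrite tE -rmorphXn -rmorphM mulrA -exprD subnKC.
pose phi m := F m (nu m).
have phiE m n : (nu m <= n)%N -> local p (F m n - phi m) by exact: nuP.
have [|g [gL gloc _]] := local_lift R_PID emb_inj emb_frac hsM pp (phi := phi).
  move=> r x y; pose n := maxn (nu (r *: x + y)) (maxn (nu x) (nu y)).
  have l1 := phiE (r *: x + y) n (leq_maxl _ _).
  have l2 := phiE x n (leq_trans (leq_maxl _ _) (leq_maxr _ _)).
  have l3 := phiE y n (leq_trans (leq_maxr _ _) (leq_maxr _ _)).
  have := localD pp (localD pp (localM pp (local_int emb pp r) l2) l3) (localN pp l1).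
  by congr (local p); rewrite FL; ring.
(* The values of [g] at [x] and the [xs] need not lie in [R_p]; they are coded as colours and
   predicted by means of [q]. *)
have [f fP] := monochromatic_uniformization (fun b => values_code (values g b)).
exists (fun b => (f b).+1) => b b' n Bb Bb' fb fb' nE.
have n0 : (0 < n)%N by apply: leq_trans fb.
have vE : values g b = values g b'.
  by apply/values_code_inj/(fP b b' n) => //; apply: ltnW.
have gz := Klinear_quotient_eq gL Bb Bb' n0 nE vE.
have zloc : local p (phi (wz b n - wz b' n)).
  by apply/gloc; rewrite (KlinearB gL) gz subrr; have := local_int emb pp 0; rewrite rmorph0.
pose N := maxn n (nu (wz b n - wz b' n)).
have Floc : local p (F (wz b n - wz b' n) N).
  by rewrite -[F _ N](subrK (phi (wz b n - wz b' n))); apply: localD => //; apply/phiE/leq_maxr.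
(* [F] is the partial sum at [x] and zero on the [xs]. The remaining term [ws b1 n] is read off the
   node, so it cancels in the difference for [b] and [b']. *)
have FxsE b1 : B b1 -> p%:F ^+ n * F (wz b1 n) N = (sig b1 N)%:F - F (ws b1 n) N.
  move=> Bb1; rewrite (Klinear_quotient (FL N)) //= Fx // big1 ?addr0 // => i _.
  by rewrite (nth_map 0) // (Fxs b1) ?mulr0 // mem_nth.
have wsE : ws b n = ws b' n.
  by case: n n0 nE {fb fb' gz zloc N Floc FxsE} => // n _ /node_eq/(_ (leqnn _))/branch_wit[].
have dN : divides (p ^+ n) (sig b N - sig b' N).
  apply/(local_div_exp emb_inj pp); move: Floc; congr (local p).
  apply: (mulfI (expf_neq0 n p0)).
  rewrite (KlinearB (FL N)) mulrBr !FxsE // wsE rmorphB /= opprB addrA subrK.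
  by field; rewrite expf_neq0.
(* The terms of index at least [n] are multiples of [p ^+ n], so [N] can be lowered to [n]. *)
have dsig b1 : divides (p ^+ n) (sig b1 N - sig b1 n).
  have : (n <= N)%N by exact: leq_maxl.
  elim: N {Floc FxsE dN} => [|k IH]; first by rewrite leqn0 => /eqP ->; rewrite subrr; apply: divides0.
  rewrite leq_eqVlt => /orP[/eqP <-|]; first by rewrite subrr; apply: divides0.
  rewrite ltnS => nk; rewrite /sig big_ord_recr /= addrAC; apply: dividesD; first exact: IH.
  exact/dividesMr/divides_exp.
have := dividesD dN (dividesD (dividesN (dsig b)) (dsig b')); congr (divides _).
by rewrite -/(sig b n) -/(sig b' n); ring.
Qed.

End Monochromatic.
End Uniformization.

(** * The ladder module *)

Section LinearOf.
Variables (R : idomainType) (U V : lmodType R) (h : U -> V).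

Definition linear_of of linear h : U -> V := h.

Variable hL : linear h.

HB.instance Definition _ := GRing.isLinear.Build R U V *:%R (linear_of hL) hL.

Lemma linear_ofE : exists H : {linear U -> V}, forall x, H x = h x.
Proof. by exists (GRing.Linear.clone R U V *:%R (linear_of hL) _). Qed.

End LinearOf.

Section Countability.

Lemma countable_seq (T : Type) (A : set T) : countable A ->
  countable [set s : seq T | forall i, (i < size s)%N -> forall d, A (nth d s i)].
Proof.
move=> /countable_injP[f finj]; apply/countable_injP.
exists (fun s => pickle (map f s)) => s t; rewrite !inE => sA tA /(pcan_inj pickleK).
elim: s t sA tA => [|x s IH] [|y t] //= sA tA [fxy fst].
have -> : x = y by apply: finj => //; rewrite inE; [apply: (sA 0%N) | apply: (tA 0%N)].
by rewrite (IH t) // => i ik d; [apply: (sA i.+1) | apply: (tA i.+1)].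
Qed.

Lemma countable_span (R : idomainType) (M : lmodType R) (A : set M) :
  countable [set: R] -> countable A -> countable (span A).
Proof.
move=> cR cA.
have c := countable_seq (countableX cR cA).
apply: sub_countable (c : countable _); apply: card_le_trans (card_image_le (fun l : seq (R * M) =>
  \sum_(i <- l) i.1 *: i.2) _).
apply: subset_card_le => m [l lA ->]; exists l => // i il d /=; split=> //=.
exact/lA/mem_nth.
Qed.

Lemma span_family (R : idomainType) (M : lmodType R) (T : eqType) (F : T -> M) m :
  span (range F) m -> exists (l : seq T) (c : T -> R), uniq l /\ m = \sum_(t <- l) c t *: F t.
Proof.
move=> [k kF ->]; have [->|/eqP k0] := eqVneq k [::]; first by exists [::], (fun=> 0); rewrite !big_nil.
have [t0] : exists t : T, True by case: k kF k0 => // j k /(_ j (mem_head _ _))[t]; exists t.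
have /choice[g gP] i : exists t, i \in k -> F t = i.2.
  by have [/kF[t _ tE]|ik] := boolP (i \in k); [exists t | exists t0].
exists (undup [seq g i | i <- k]), (fun t => \sum_(i <- k | g i == t) i.1).
split; first exact: undup_uniq.
under [RHS]eq_bigr do rewrite scaler_suml.
rewrite (exchange_big_dep xpredT) //= big_seq [RHS]big_seq; apply: eq_bigr => i ik.
rewrite -big_filter (@eq_filter _ _ (pred1 (g i))) => [|x]; last by rewrite /= eq_sym.
by rewrite filter_pred1_uniq ?undup_uniq ?mem_undup ?map_f // big_seq1 gP.
Qed.

End Countability.

Section LadderModule.
Variables (R : idomainType) (R_PID : is_PID R) (p : R) (pp : prime_element p).
Variables (L : choiceType) (M : choiceType) (B : set M) (br : M -> nat -> L).
Hypothesis br_inj : forall b b', B b -> B b' -> (forall n, br b n = br b' n) -> b = b'.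
Local Notation T := (seq L).
Local Notation nd b n := (mkseq (br b) n).

Definition leaf (t : T) : T -> R^o := fun t' => (t' == t)%:R.

(** The formal sum of [p ^ (k - n - 1)] times the [k]-th node over all [k > n]. It solves the
    recursion for [y_n], so the module can be realized inside a power of [R]. *)
Definition ladder b n : T -> R^o := fun t =>
  if (n < size t)%N && (t == nd b (size t)) then p ^+ (size t - n.+1) else 0.

Definition ladder_gen : set (T -> R^o) :=
  [set v | (exists t, v = leaf t) \/ (exists b n, B b /\ v = ladder b n)].

Lemma nd_size b n : size (nd b n) = n.
Proof. exact: size_mkseq. Qed.

Lemma take_nd b m n : (m <= n)%N -> take m (nd b n) = nd b m.
Proof.
move=> mn; rewrite /mkseq -map_take take_iota; congr map; congr iota; exact/minn_idPl.
Qed.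

Lemma ladder_step b n : ladder b n = leaf (nd b n.+1) + p *: ladder b n.+1.
Proof.
apply/funext => t; rewrite /ladder /leaf /= -[RHS]/((t == nd b n.+1)%:R + p * _).
have [tn|tn|tn] := ltngtP (size t) n.+1.
- have -> : (t == nd b n.+1) = false by apply/eqP => E; rewrite E nd_size ltnn in tn.
  by rewrite /= mulr0 addr0.
- have -> : (t == nd b n.+1) = false by apply/eqP => E; rewrite E nd_size ltnn in tn.
  rewrite add0r /=; case: eqP => _; rewrite ?mulr0 // -exprS; congr (_ ^+ _).
  by rewrite subnSK.
- rewrite tn /= mulr0 addr0 subnn expr0.
  by case: eqP.
Qed.

Lemma separate b (l : seq M) : B b -> (forall b', b' \in l -> B b') -> b \notin l ->
  exists k, forall n b', (k <= n)%N -> b' \in l -> nd b n <> nd b' n.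
Proof.
move=> Bb; elim: l => [|b' l IH] lB; first by exists 0%N.
rewrite inE negb_or => /andP[/eqP bb' bl].
have [|k kP] := IH _ bl; first by move=> b1 b1l; apply: lB; rewrite inE b1l orbT.
have [i bi] : exists i, br b i <> br b' i.
  by apply: contrapT => /forallNP ni; apply: bb'; apply: br_inj => // [|n];
    [apply: lB; exact: mem_head | apply: contrapT; exact: ni].
exists (maxn k i.+1) => n b1; rewrite geq_max => /andP[kn ni]; rewrite inE => /orP[/eqP ->|].
  by move=> E; apply: bi; have := congr1 (fun s => nth (br b i) s i) E; rewrite !nth_mkseq.
exact: kP.
Qed.

(** Evaluation far out along the branch of [b] kills the leaves and the ladders of all other
    branches, but not those of [b]. *)
Definition vanishing b : set (T -> R^o) :=
  [set v | exists k, forall n, (k <= n)%N -> v (nd b n) = 0].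

Lemma vanishing_submodule b : submodule (vanishing b).
Proof.
split; first by exists 0%N.
move=> r x y [k kx] [l ly]; exists (maxn k l) => n; rewrite geq_max => /andP[kn ln].
by rewrite -[LHS]/(r * x (nd b n) + y (nd b n)) kx // ly // mulr0 addr0.
Qed.

Lemma vanishing_leaf b t : vanishing b (leaf t).
Proof.
exists (size t).+1 => n nt; rewrite /leaf; case: eqP => // E.
by rewrite -E nd_size ltnn in nt.
Qed.

Lemma vanishing_ladder b b' n : B b -> B b' -> b <> b' -> vanishing b (ladder b' n).
Proof.
move=> Bb Bb' bb'; have [||k kP] := @separate b [:: b'] Bb.
- by move=> b1; rewrite inE => /eqP ->.
- by rewrite inE; apply/eqP.
exists k => m km; rewrite /ladder nd_size; case: eqP => [/kP|]; last by rewrite andbF.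
by move=> /(_ km (mem_head _ _)).
Qed.

Lemma ladder_nd b n k : (n < k)%N -> ladder b n (nd b k) = p ^+ (k - n.+1).
Proof. by move=> nk; rewrite /ladder nd_size nk eqxx. Qed.

Lemma pow_neq0 n : p ^+ n != 0.
Proof. by apply: expf_neq0; case: pp. Qed.

Lemma ladder_independent (l : seq M) (c : M -> R) n q : uniq l -> (forall b, b \in l -> B b) ->
  span (range leaf) q -> q + \sum_(b <- l) c b *: ladder b n = 0 -> forall b, b \in l -> c b = 0.
Proof.
move=> ul lB qs sum0 b bl; have Bb := lB b bl.
have [k kP] : vanishing b (q + \sum_(b' <- l | b' != b) c b' *: ladder b' n).
  have subV := vanishing_submodule b; apply: submoduleD => //.
    by apply: (span_sub subV) qs => _ [t _ <-]; exact: vanishing_leaf.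
  rewrite big_mkcond /=; apply: submodule_sum => // b' b'l.
  case: ifP => [/eqP b'b|_]; last exact: subV.1.
  by apply: submoduleZ => //; apply: vanishing_ladder => //; [exact: lB | exact/nesym].
pose m := maxn k n.+1; have := congr1 (fun v : T -> R^o => v (nd b m)) sum0.
rewrite (bigD1_seq b) //= addrCA -[LHS]/(c b * ladder b n (nd b m) + (q + \sum_(b' <- l | b' != b) c b' *: ladder b' n) (nd b m)).
rewrite kP ?leq_maxl // addr0 ladder_nd ?leq_maxr // => /eqP.
by rewrite mulf_eq0 (negbTE (pow_neq0 _)) orbF => /eqP.
Qed.

Lemma leaf_independent (l : seq T) (c : T -> R) : uniq l ->
  \sum_(t <- l) c t *: leaf t = 0 -> forall t, t \in l -> c t = 0.
Proof.
move=> ul sum0 t tl; have := congr1 (fun v : T -> R^o => v t) sum0.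
rewrite fct_sumE (bigD1_seq t) //= big1 => [|t' t't].
  by rewrite addr0 -[(_ *: _) t]/(c t * leaf t t) /leaf eqxx mulr1.
by rewrite -[(_ *: _) t]/(c t' * leaf t' t) /leaf eq_sym (negbTE t't) mulr0.
Qed.

Section Whitehead.
Hypothesis uniformizable : forall c : M -> nat -> R, exists f : M -> nat,
  forall b b' n, B b -> B b' -> (f b <= n)%N -> (f b' <= n)%N -> nd b n = nd b' n ->
  divides (p ^+ n) (\sum_(i < n) p ^+ i * c b i - \sum_(i < n) p ^+ i * c b' i).
Variables (S : submodClosed (T -> R^o)).
Hypothesis SE : forall v, (v \in S) = `[< span ladder_gen v >].

(** With [h] predicting the partial sums, take [psi] at a node of length [n + 1] to be the increment
    of [h] over its parent divided by [p ^+ n], and [d b n] the prediction error divided by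
    [p ^+ n]. Both divisions are exact from level [f b] on. *)
Lemma coboundary (c : M -> nat -> R) : exists (f : M -> nat) (psi : T -> R) (d : M -> nat -> R),
  forall b n, B b -> (f b <= n)%N -> c b n - psi (nd b n.+1) = p * d b n.+1 - d b n.
Proof.
have [f fP] := uniformizable c; pose sig b n := \sum_(i < n) p ^+ i * c b i.
have /choice[h hP] t : exists r, forall b, B b -> (f b <= size t)%N -> t = nd b (size t) ->
    divides (p ^+ size t) (sig b (size t) - r).
  have [[b0 [Bb0 fb0 tb0]]|nb] := EM (exists b, [/\ B b, (f b <= size t)%N & t = nd b (size t)]).
    exists (sig b0 (size t)) => b Bb fb tb; apply: fP => //.
    by rewrite -tb -tb0.
  by exists 0 => b Bb fb tb; case: nb; exists b.
have /choice[psi psiP] t : exists r, divides (p ^+ (size t).-1) (h t - h (take (size t).-1 t)) ->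
    h t - h (take (size t).-1 t) = r * p ^+ (size t).-1.
  have [[r rE]|nd] := EM (divides (p ^+ (size t).-1) (h t - h (take (size t).-1 t))).
    by exists r.
  by exists 0.
have /choice[d dP] bn : exists r, B bn.1 -> (f bn.1 <= bn.2)%N ->
    sig bn.1 bn.2 - h (nd bn.1 bn.2) = r * p ^+ bn.2.
  have [[Bb fb]|nb] := EM (B bn.1 /\ (f bn.1 <= bn.2)%N); last first.
    by exists 0 => Bb fb; case: nb.
  have := hP (nd bn.1 bn.2) bn.1; rewrite nd_size => /(_ Bb fb erefl)[r rE].
  by exists r.
exists f, psi, (fun b n => d (b, n)) => b n Bb fb.
have fb1 : (f b <= n.+1)%N by exact: leqW.
have E0 := dP (b, n) Bb fb; have E1 := dP (b, n.+1) Bb fb1; rewrite /= in E0 E1.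
have sS : sig b n.+1 = sig b n + p ^+ n * c b n by rewrite /sig big_ord_recr.
have := psiP (nd b n.+1); rewrite nd_size /= take_nd // => hE.
have {}hE : h (nd b n.+1) - h (nd b n) = psi (nd b n.+1) * p ^+ n.
  apply: hE; exists (c b n + d (b, n) - p * d (b, n.+1)).
  have -> : h (nd b n.+1) - h (nd b n) = (sig b n - h (nd b n)) - (sig b n.+1 - h (nd b n.+1)) +
      p ^+ n * c b n by rewrite sS; ring.
  by rewrite E0 E1 exprS; ring.
apply: (mulIf (pow_neq0 n)).
have -> : (c b n - psi (nd b n.+1)) * p ^+ n =
  (sig b n.+1 - h (nd b n.+1)) - (sig b n - h (nd b n)).
  by rewrite mulrBl -hE sS; ring.
by rewrite E0 E1 exprS; ring.
Qed.

(** Lifts of the generators to an extension satisfy the ladder relations up to scalars [c']. By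
    [coboundary] the lifts can be corrected so that the relations hold far out on each branch; the
    corrected lifts then span a complement of the image of [R]. *)
Lemma ladder_whitehead : whitehead (submod S).
Proof.
move=> E; case: E => E i pr i_inj pr_surj ex; rewrite /ext_equiv /=.
have ex0 e : pr e = 0 -> exists r : R, e = i r.
  by move=> /ex[r <-]; exists r.
have pri r : pr (i r) = 0 by apply/ex; exists r.
have subG := span_submodule ladder_gen.
have leafS t : leaf t \in S by rewrite SE; apply/asboolP/span_self; left; exists t.
have ladderS b n : B b -> ladder b n \in S.
  by move=> Bb; rewrite SE; apply/asboolP/span_self; right; exists b, n.
have /choice[et etP] t : exists e, val (pr e) = leaf t.
  by have [e eE] := pr_surj (Sub (leaf t) (leafS t)); exists e; rewrite eE SubK.
have /choice[ey eyP] bn : exists e, B bn.1 -> val (pr e) = ladder bn.1 bn.2.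
  have [Bb|] := EM (B bn.1); last by exists 0.
  by have [e eE] := pr_surj (Sub (ladder bn.1 bn.2) (ladderS _ bn.2 Bb)); exists e; rewrite eE SubK.
have /choice[c' cP] bn : exists r : R, B bn.1 ->
    i r = ey bn - (et (nd bn.1 bn.2.+1) + p *: ey (bn.1, bn.2.+1)).
  have [Bb|] := EM (B bn.1); last by exists 0.
  have [|r rE] := ex0 (ey bn - (et (nd bn.1 bn.2.+1) + p *: ey (bn.1, bn.2.+1))); last by exists r.
  apply: val_inj; rewrite linearB linearD linearZ GRing.valB GRing.valD GRing.valZ.
  by rewrite etP !eyP //= ladder_step subrr.
have [f [psi [d dP]]] := coboundary (fun b n => c' (b, n)).
pose s t := et t + i (psi t); pose sy b n := ey (b, n) + i (d b n).
have prs t : val (pr (s t)) = leaf t by rewrite linearD pri addr0 etP.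
have prsy b n : B b -> val (pr (sy b n)) = ladder b n by move=> Bb; rewrite linearD pri addr0 eyP.
have sy_step b n : B b -> (f b <= n)%N -> sy b n = s (nd b n.+1) + p *: sy b n.+1.
  move=> Bb fb; have Ec := cP (b, n) Bb; have Ed := dP b n Bb fb; rewrite /= in Ec.
  apply/eqP; rewrite -subr_eq0 /sy /s scalerDr; apply/eqP.
  have -> : forall a b c d e h : E, a + b - (c + d + (e + h)) = (a - (c + e)) + (b - (d + h)).
    by move=> *; rewrite [X in _ - X]addrACA opprD addrACA.
  have iD (x y : R) : i (x + y) = i x + i y by exact: linearD.
  have iN (x : R) : i (- x) = - i x by exact: linearN.
  have iZ r (x : R) : i (r * x) = r *: i x by exact: linearZ.
  rewrite -Ec -iZ -iD -iN -!iD.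
  have -> : c' (b, n) + (d b n - (psi (nd b n.+1) + p * d b n.+1)) =
    c' (b, n) - psi (nd b n.+1) - (p * d b n.+1 - d b n) by ring.
  by rewrite Ed subrr linear0.
pose P := span (range s).
have subP : submodule P by exact: span_submodule.
(* Modulo the lifted leaves, a lifted ladder is a power of [p] times any later one, so finitely many
   can be brought to one level. *)
have raise b m n : B b -> (f b <= m)%N -> (m <= n)%N -> P (sy b m - p ^+ (n - m) *: sy b n).
  move=> Bb fm /subnK <-; rewrite addnK; elim: (n - m)%N => [|k IH].
    by rewrite expr0 scale1r subrr; exact: subP.1.
  have := submoduleD subP IH (submoduleZ subP (p ^+ k) (span_self (ex_intro2 _ _ (nd b (k + m).+1) I erefl))).
  congr P; rewrite [in LHS](@sy_step b (k + m)) //; last by apply: leq_trans (leq_addl _ _).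
  rewrite scalerDr opprD addrA scalerA -exprSr addSn.
  by rewrite addrAC subrK.
(* The complement, in normal form: one common level [n], beyond [f b] for every branch involved. *)
pose E' e := exists l n (c : M -> R), [/\ uniq l, forall b, b \in l -> B b /\ (f b <= n)%N,
  forall b, b \notin l -> c b = 0 & P (e - \sum_(b <- l) c b *: sy b n)].
have E'lift e l n (c : M -> R) n' : (forall b, b \in l -> B b /\ (f b <= n)%N) -> (n <= n')%N ->
    P (e - \sum_(b <- l) c b *: sy b n) -> P (e - \sum_(b <- l) (c b * p ^+ (n' - n)) *: sy b n').
  move=> lB nn Pe; rewrite -[e](subrK (\sum_(b <- l) c b *: sy b n)) -addrA.
  apply: submoduleD => //; rewrite -sumrB; apply: submodule_sum => // b bl.
  have [Bb fb] := lB b bl; rewrite -scalerA -scalerBr; apply: submoduleZ => //.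
  exact: raise.
have subE' : submodule E'.
  split.
    exists [::], 0%N, (fun=> 0); split=> //; rewrite big_nil subr0; exact: subP.1.
  move=> r e1 e2 [l1 [n1 [c1 [u1 B1 c10 P1]]]] [l2 [n2 [c2 [u2 B2 c20 P2]]]].
  pose n := maxn n1 n2; pose l := undup (l1 ++ l2); have ul : uniq l by exact: undup_uniq.
  have s1 : {subset l1 <= l} by move=> b bl; rewrite mem_undup mem_cat bl.
  have s2 : {subset l2 <= l} by move=> b bl; rewrite mem_undup mem_cat bl orbT.
  have := E'lift _ _ _ _ n B1 (leq_maxl _ _) P1; have := E'lift _ _ _ _ n B2 (leq_maxr _ _) P2.
  rewrite -(sum_sub u1 ul s1) => [|b /c10 ->]; last by rewrite mul0r scale0r.
  rewrite -(sum_sub u2 ul s2) => [|b /c20 ->]; last by rewrite mul0r scale0r.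
  move=> P2' P1'; exists l, n, (fun b => r * (c1 b * p ^+ (n - n1)) + c2 b * p ^+ (n - n2)).
  split=> //.
  - move=> b; rewrite mem_undup mem_cat => /orP[/B1|/B2] [Bb fb]; split=> //; apply: leq_trans fb _.
      exact: leq_maxl.
    exact: leq_maxr.
  - move=> b; rewrite mem_undup mem_cat negb_or => /andP[/c10 -> /c20 ->].
    by rewrite !mul0r mulr0 addr0.
  have := subP.2 r _ _ P1' P2'; congr P.
  rewrite scalerBr addrACA -opprD scaler_sumr -big_split; congr (_ - _).
  by apply: eq_bigr => b _; rewrite /= scalerA -scalerDl.
(* The complement meets the kernel of [pr] trivially: the ladder coefficients vanish by independence
   modulo the leaves, then those of the leaves. *)
have E'0 e : E' e -> pr e = 0 -> e = 0.
  move=> [l [n [c [ul lB c0 Pe]]]] pre.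
  have valpr (I : eqType) (k : seq I) (a : I -> R) (F : I -> E) :
      val (pr (\sum_(j <- k) a j *: F j)) = \sum_(j <- k) a j *: val (pr (F j)).
    elim: k => [|j k IH]; first by rewrite !big_nil !linear0.
    by rewrite !big_cons linearD linearZ GRing.valD GRing.valZ IH.
  have c_0 : forall b, b \in l -> c b = 0.
    apply: (@ladder_independent l c n (val (pr (e - \sum_(b <- l) c b *: sy b n)))) => //.
    - by move=> b /lB[].
    - have [k [a [uk ->]]] := span_family Pe; rewrite valpr.
      apply: submodule_sum => [|t _]; first exact: span_submodule.
      by apply: submoduleZ; [exact: span_submodule | rewrite prs; apply: span_self; exists t].
    rewrite linearB pre sub0r GRing.valN valpr.
    rewrite [X in - X + _]big_seq [X in _ + X]big_seq.
    rewrite [X in - X + _](eq_bigr (fun b => c b *: ladder b n)) ?addNr //.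
    by move=> b /lB[Bb _]; rewrite prsy.
  move: Pe; rewrite big_seq big1 => [|b /c_0 ->]; last by rewrite scale0r.
  rewrite subr0 => /span_family[k [a [uk eE]]].
  have a0 : forall t, t \in k -> a t = 0.
    apply: leaf_independent => //; have := congr1 (fun x => val (pr x)) eE.
    rewrite pre valpr linear0 => E0; rewrite [RHS]E0.
    by apply: eq_bigr => t _; rewrite prs.
  by rewrite eE big_seq big1 // => t /a0 ->; rewrite scale0r.
have E's t : E' (s t).
  exists [::], 0%N, (fun=> 0); split=> //; rewrite big_nil subr0.
  by apply: span_self; exists t.
have E'sy b n : B b -> (f b <= n)%N -> E' (sy b n).
  move=> Bb fb; exists [:: b], n, (fun b' => (b' == b)%:R); split=> //.
  - by move=> b'; rewrite inE => /eqP ->.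
  - by move=> b'; rewrite inE => /negbTE ->.
  by rewrite big_seq1 eqxx scale1r subrr; exact: subP.1.
(* Ladders below level [f b] have no corrected lift of their own; they are reached by descending
   along the recursion. *)
have E'surj v : exists e, E' e /\ pr e = v.
  pose Z : set (T -> R^o) := [set w | exists e, E' e /\ val (pr e) = w].
  have subZ : submodule Z.
    split; first by exists 0; split; [exact: subE'.1 | rewrite !linear0].
    move=> r _ _ [e [Ee <-]] [e' [Ee' <-]]; exists (r *: e + e'); split; first exact: subE'.2.
    by rewrite linearD linearZ GRing.valD GRing.valZ.
  have Zladder b n : B b -> Z (ladder b n).
    move=> Bb; have [k] := ubnP (f b - n)%N; elim: k n => // k IH n fk.
    have [fb|nf] := leqP (f b) n; first by exists (sy b n); split; [exact: E'sy|exact: prsy].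
    rewrite ladder_step; apply: submoduleD => //; first by exists (s (nd b n.+1)).
    by apply: submoduleZ => //; apply: IH; rewrite subnS -ltnS prednK // subn_gt0.
  have : Z (val v).
    have : span ladder_gen (val v) by apply/asboolP; rewrite -SE; exact: valP.
    apply: (span_sub subZ) => w [[t ->]|[b [n [Bb ->]]]]; last exact: Zladder.
    by exists (s t).
  by move=> [e [Ee /val_inj prE]]; exists e.
have /choice[rho rhoP] e : exists r : R^o, E' (e - i r).
  have [e' [Ee' pre']] := E'surj (pr e).
  have [|r rE] := ex0 (e - e'); first by rewrite linearB pre' subrr.
  by exists r; rewrite -rE opprB addrC subrK.
have rho_uniq e r : E' (e - i r) -> rho e = r.
  move=> Er; apply: i_inj; apply/eqP; rewrite -subr_eq0; apply/eqP; apply: E'0.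
    have := submoduleB subE' Er (rhoP e); congr E'.
    by rewrite opprB addrC addrA subrK.
  by rewrite linearB !pri subrr.
have [|H HE] := @linear_ofE R E (R^o * submod S)%type (fun e => (rho e, pr e)).
  move=> r x y; congr (_, _); last by rewrite linearP.
  apply: rho_uniq; have := subE'.2 r _ _ (rhoP x) (rhoP y); congr E'.
  by rewrite linearP scalerBr addrACA -opprD.
exists H; split=> [r|e]; last by rewrite HE.
rewrite HE pri /split_inj; congr (_, _); apply: rho_uniq.
by rewrite subrr; exact: subE'.1.
Qed.

End Whitehead.
End LadderModule.

(** * Cardinality and freeness of the ladder module *)

Section LadderSize.
Variables (R : idomainType) (R_PID : is_PID R) (R_countable : countable [set: R]).
Variables (p : R) (pp : prime_element p).
Variables (L : choiceType) (M : choiceType) (B : set M) (br : M -> nat -> L).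
Hypothesis br_inj : forall b b', B b -> B b' -> (forall n, br b n = br b' n) -> b = b'.
Variables (le : rel M) (wo : well_order le) (unM : ~ countable [set: M]).
Hypothesis cM : forall x, countable [set y | le y x].
Variable top : L -> M.
Hypothesis top_countable : forall x, countable [set d | le (top d) x].
Hypothesis top_br : forall b n, B b -> slt le (top (br b n)) b.
Local Notation T := (seq L).
Local Notation nd b n := (mkseq (br b) n).
Variables (S : submodClosed (T -> R^o)).
Hypothesis SE : forall v, (v \in S) = `[< span (ladder_gen p B br) v >].

(** Generators of the countable stage [a] of a filtration of the module along the well-order of [M];
    [top] bounds the elements occurring in a label. *)
Definition ladder_gen_le a : set (T -> R^o) := [set v |
  (exists t, (forall d, d \in t -> le (top d) a) /\ v = leaf R t) \/
  (exists b n, [/\ B b, le b a & v = ladder p br b n])].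

Definition ladder_le a := span (ladder_gen_le a).

Lemma ladder_leW a a' : le a a' -> ladder_le a `<=` ladder_le a'.
Proof.
move=> aa'; apply: span_sub; first exact: span_submodule.
move=> v vG; apply: span_self; case: vG => [[t [ta ->]]|[b [n [Bb ba ->]]]].
  by left; exists t; split=> // d /ta da; apply: (wo_trans wo) aa'.
by right; exists b, n; split=> //; apply: (wo_trans wo) aa'.
Qed.

Lemma ladder_le_countable a : countable (ladder_le a).
Proof.
apply: countable_span => //.
have cT : countable [set t : T | forall d, d \in t -> le (top d) a].
  apply: sub_countable (countable_seq (top_countable a)).
  by apply: subset_card_le => t ta i it d; apply: ta; apply: mem_nth.
pose F (i : bool) := if i then @leaf R L @` [set t : T | forall d, d \in t -> le (top d) a]
  else (fun bn => ladder p br bn.1 bn.2) @` ([set b | le b a] `*` [set: nat]).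
apply: (@sub_countable _ _ _ (\bigcup_(i in [set: bool]) F i)).
  apply: subset_card_le => v [[t [ta ->]]|[b [n [Bb ba ->]]]].
    by exists true => //; exists t.
  by exists false => //; exists (b, n).
apply: bigcup_countable => // -[] _.
  exact: sub_countable (card_image_le _ _) cT.
by apply: sub_countable (card_image_le _ _) _; apply: countableX.
Qed.

Lemma ladder_le_exists v : span (ladder_gen p B br) v -> exists a, ladder_le a v.
Proof.
have [m0 _] : exists m0 : M, True.
  apply: contrapT => nM; apply: unM; apply: sub_countable (countable0 M).
  by apply: subset_card_le => m; case: nM; exists m.
apply: (@span_sub _ _ _ [set v | exists a, ladder_le a v]).
  split; first by exists m0; exact: (span_submodule _).1.
  move=> r x y [a ax] [a' a'y]; have [aa|aa] := wo_total wo a a'.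
    by exists a'; apply: (span_submodule _).2 => //; apply: ladder_leW ax.
  by exists a; apply: (span_submodule _).2 => //; apply: ladder_leW a'y.
move=> w [[t ->]|[b [n [Bb ->]]]].
  have [t0|t0] := eqVneq t [::].
    by exists m0; apply: span_self; left; exists t; rewrite t0.
  have [d dt dmax] := wo_max_seq wo top t0.
  by exists (top d); apply: span_self; left; exists t.
by exists b; apply: span_self; right; exists b, n; split=> //; exact: wo_refl.
Qed.

Lemma submod_countable a : countable [set v : submod S | ladder_le a (val v)].
Proof.
have /countable_injP[f finj] := ladder_le_countable a; apply/countable_injP.
exists (f \o val) => v w; rewrite !inE => va wa /= fvw; apply: val_inj.
by apply: finj => //; rewrite inE.
Qed.

(** The leaves at nodes of length one are uncountably many. For the order, elements are ranked by
    the first stage containing them, and the countable fibres are ordered by [lexicographic]. *)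
Lemma ladder_card (iota : M -> L) : injective iota -> has_card_aleph1 (submod S).
Proof.
move=> iota_inj; have leafS t : leaf R t \in S.
  by rewrite SE; apply/asboolP/span_self; left; exists t.
split.
  move=> /countable_injP[f finj]; apply: unM; apply/countable_injP.
  exists (fun m => f (Sub (leaf R [:: iota m]) (leafS _))) => m m' _ _.
  move=> /finj; rewrite !inE => /(_ I I)/(congr1 val); rewrite !SubK.
  move=> /(congr1 (fun v : T -> R^o => v [:: iota m])); rewrite /leaf eqxx.
  by case: eqP => [[/iota_inj]|_ /eqP] //; rewrite oner_eq0.
have /choice[rho rhoP] (v : submod S) : exists a, ladder_le a (val v) /\
    forall a', ladder_le a' (val v) -> le a a'.
  have [|a av amin] := wo_min wo (P := [set a | ladder_le a (val v)]).
    by apply: ladder_le_exists; apply/asboolP; rewrite -SE; exact: valP.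
  by exists a.
have [|le' [wo' le'le _]] := @lexicographic _ _ wo (submod S) rho.
  move=> a; apply: sub_countable (submod_countable a).
  by apply: subset_card_le => v /= <-; exact: (rhoP v).1.
exists le'; split=> // v; apply: sub_countable (submod_countable (rho v)).
by apply: subset_card_le => w /= /le'le; move=> /ladder_leW; apply; exact: (rhoP w).1.
Qed.

(* If the module is free on a basis Omega, then for a closed [a] the span of what lies below
   [a] is spanned by a part of Omega, so the quotient is free; but the class of [ladder a 0] is a
   nonzero element of the quotient divisible by all [p ^+ n]. *)
Lemma ladder_free_closed : is_free (submod S) ->
  exists G : M -> M, forall a, (forall y, slt le y a -> slt le (G y) a) -> ~ B a.
Proof.
move=> /free_coord[co [coL coE]].
have /choice[supp suppP] := coE.
have inS v : val v \in S := valP v.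
have /choice[h hP] (w : submod S) : exists a, ladder_le a (val w).
  by apply: ladder_le_exists; apply/asboolP; rewrite -SE.
(* [G y] bounds the stages of all basis elements in the supports of stage [y]; at a closed [a], the
   part [Nlt] below [a] is then closed under taking supports. *)
have /choice[G GP] y : exists u, forall v w, ladder_le y (val v) -> co v w <> 0 -> slt le (h w) u.
  have [|u uP] := @countable_bounded _ le
      (\bigcup_(v in [set v : submod S | ladder_le y (val v)]) h @` [set` supp v]) unM cM.
    apply: bigcup_countable; first exact: submod_countable.
    move=> v _; apply: sub_countable (card_image_le _ _) _.
    exact/finite_set_countable/finite_seq.
  exists u => v w vy covw; apply: uP; exists v => //; exists w => //=.
  by have [_ c0 _] := suppP v; apply: contrapT => /negP/c0.
exists G => a ca Ba.
pose Nlt := [set v | exists2 y, slt le y a & ladder_le y v].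
have subN : submodule Nlt.
  split.
    by exists (top (br a 0%N)); [exact: top_br | exact: (span_submodule _).1].
  move=> r x y [u ua ux] [w wa wy]; have [uw|wu] := wo_total wo u w.
    by exists w => //; apply: (span_submodule _).2 => //; exact: ladder_leW uw _ ux.
  by exists u => //; apply: (span_submodule _).2 => //; exact: ladder_leW wu _ wy.
have Nlt_vanishing : Nlt `<=` vanishing br a.
  move=> v [y ya]; apply: span_sub; first exact: vanishing_submodule.
  move=> w [[t [_ ->]]|[b [n [Bb bay ->]]]]; first exact: vanishing_leaf.
  apply: (vanishing_ladder p br_inj) => // ab.
  by move: (le_slt_trans wo bay ya); rewrite ab; apply: (slt_irr wo).
have ladderS n : ladder p br a n \in S.
  by rewrite SE; apply/asboolP/span_self; right; exists a, n.
pose Y n : submod S := Sub (ladder p br a n) (ladderS n).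
have YN n : Nlt (val (Y 0%N - p ^+ n *: Y n)).
  rewrite GRing.valB GRing.valZ !SubK; elim: n => [|n IH].
    by rewrite expr0 scale1r subrr; exact: subN.1.
  have lN : Nlt (leaf R (nd a n.+1)).
    have [|d dt dmax] := wo_max_seq wo top (s := nd a n.+1).
      by rewrite -size_eq0 size_mkseq.
    exists (top d); last by apply: span_self; left; exists (nd a n.+1).
    by have /mapP[i _ ->] := dt; exact: top_br.
  have := submoduleD subN IH (submoduleZ subN (p ^+ n) lN); congr Nlt.
  by rewrite (ladder_step p br a n) scalerDr opprD addrA scalerA -exprSr addrAC subrK.
have coNlt v w : Nlt (val v) -> co v w <> 0 -> Nlt (val w).
  move=> [y ya yv] covw; exists (h w); last exact: hP.
  exact: (slt_le_trans wo (GP y v w yv covw) (sltW wo (ca y ya))).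
have coB v w u : co (v - w) u = co v u - co w u.
  by rewrite addrC -scaleN1r coL mulN1r addrC.
have coZ r v u : co (r *: v) u = r * co v u.
  have co0 : co 0 u = 0 by have := coB 0 0 u; rewrite !subrr.
  by have := coL u r v 0; rewrite addr0 co0 addr0.
(* A coordinate of [Y 0] at a basis element outside [Nlt] equals [p ^+ n] times that of [Y n], for
   every [n], hence is zero. *)
have Y0N : Nlt (val (Y 0%N)).
  have [_ _ ->] := suppP (Y 0%N).
  have valsum (k : seq (submod S)) (c : submod S -> R) :
      val (\sum_(w <- k) c w *: w) = \sum_(w <- k) c w *: val w.
    elim: k => [|w k IH]; first by rewrite !big_nil linear0.
    by rewrite !big_cons GRing.valD GRing.valZ IH.
  rewrite valsum; apply: submodule_sum => // w _.
  have [wN|nwN] := EM (Nlt (val w)); first exact: submoduleZ.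
  suff -> : co (Y 0%N) w = 0 by rewrite scale0r; exact: subN.1.
  have [_ pU _] := pp; apply: (divides_pow_eq0 R_PID pU) => n; exists (co (Y n) w).
  rewrite mulrC -coZ; apply/eqP; rewrite -subr_eq0 -coB; apply/eqP.
  by apply: contrapT => /(coNlt _ _ (YN n)).
(* Elements of [Nlt] vanish far out along the branch of [a], where [ladder p br a 0] takes powers of
   [p] as values. *)
have [k kP] := Nlt_vanishing _ Y0N.
have := kP (maxn k 1) (leq_maxl _ _); rewrite SubK ladder_nd ?leq_maxr // => /eqP.
by rewrite (negbTE (pow_neq0 pp _)).
Qed.

End LadderSize.

(** * Countability of fractions and pure closures, and the choice of the Whitehead module *)

Section MainTheorem.
Variables (R : idomainType) (R_countable : countable [set: R]).

Lemma fraction_code : exists code : {fraction R} -> nat, injective code.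
Proof.
have /countable_injP[f finj] := R_countable.
have /choice[nd ndP] (q : {fraction R}) : exists ab : R * R, q = tofrac ab.1 / tofrac ab.2.
  by have [a [b [_ ->]]] := frac_repr q; exists (a, b).
exists (fun q => pickle (f (nd q).1, f (nd q).2)) => q q' /(pcan_inj pickleK)[E1 E2].
have I x : x \in [set: R] by rewrite inE.
by rewrite (ndP q) (ndP q') (finj _ _ (I _) (I _) E1) (finj _ _ (I _) (I _) E2).
Qed.

(** By torsion-freeness, [m] is recovered from a scalar [r m] and the element [r m *: m] of the
    countable span. *)
Lemma purecl_countable (M : lmodType R) (A : set M) : torsion_free M ->
  countable A -> countable (purecl A).
Proof.
move=> tf cA; have /choice[r rP] m : exists r, purecl A m -> r != 0 /\ span A (r *: m).
  by have [[r r0 rm]|] := EM (purecl A m); [exists r | exists 0].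
have /countable_injP[f finj] := countableX R_countable (countable_span R_countable cA).
apply/countable_injP; exists (fun m => f (r m, r m *: m)) => m m'; rewrite !inE => mA m'A E.
have [r0 rm] := rP m mA; have [r0' rm'] := rP m' m'A.
have [Er Em] : (r m, r m *: m) = (r m', r m' *: m') by apply: finj => //; rewrite inE.
have : r m *: (m - m') = 0 by rewrite scalerBr Em Er subrr.
by move=> /tf[/eqP|/eqP]; [rewrite (negbTE r0) | rewrite subr_eq0 => /eqP].
Qed.

End MainTheorem.

(** A prime dividing two primes is associate to both, which makes them associate to each other. *)
Lemma coprime_prime_ex (R : idomainType) (p : R) : at_least_two_primes R -> prime_element p ->
  exists2 q, prime_element q & ~ divides p q.
Proof.
move=> [q [q' [qp q'p nqq']]] pp; have [pq|] := EM (divides p q); last by exists q.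
exists q' => // pq'; apply: nqq'.
have [u uU qE] := prime_divides_associates pp qp pq.
have [u' u'U q'E] := prime_divides_associates pp q'p pq'.
by exists (u' * u^-1); rewrite ?unitrM ?unitrV ?u'U // q'E qE mulrA mulrVK.
Qed.

Theorem theorem16 (R : idomainType)
    (R_PID : is_PID R)
    (R_countable : countable [set: R]%classic)
    (R_fin_primes : finitely_many_primes R)
    (R_two_primes : at_least_two_primes R) :
  (exists M : lmodType R,
     [/\ has_card_aleph1 M, hereditarily_separable M & ~ is_free M]) ->
  exists N : lmodType R,
    [/\ has_card_aleph1 N, whitehead N & ~ is_free N].
Proof.
move=> [M [[unM [le [wo cM]]] hsM nfreeM]].
have tf := hersep_torsion_free hsM.
have [code code_inj] := fraction_code R_countable.
pose I b := [set y | slt le y b].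
pose good a := [/\ submodule (I a), is_pure (I a) & not_aleph1_free_mod (I a)].
have cI a : countable (I a).
  by apply: sub_countable (cM a); apply: subset_card_le => y; exact: sltW.
(* Outside the good points the data are dummies; [B p] contains good points only. *)
have /choice[w wP] a : exists w : R * (seq M * M) * ((nat -> M) * (nat -> M) * (nat -> nat -> R)),
    good a -> witness (I a) w.1.1 w.1.2.1 w.1.2.2 w.2.1.1 w.2.1.2 w.2.2.
  have [[subI pI badI]|] := EM (good a).
    have [p [xs [x [z [s [u wit]]]]]] := witness_ex R_PID R_fin_primes subI pI badI.
    by exists (p, (xs, x), (z, s, u)).
  by exists (0, ([::], 0), (fun=> 0, fun=> 0, fun _ => fun=> 0)).
pose wp a := (w a).1.1; pose wxs a := (w a).1.2.1; pose wx a := (w a).1.2.2.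
pose wz a := (w a).2.1.1; pose ws a := (w a).2.1.2; pose wu a := (w a).2.2.
have /choice[enum enumP] a : exists e : nat -> M, good a ->
    (forall n, I a (e n)) /\ forall y, I a y -> exists n, e n = y.
  have [[subI _ _]|] := EM (good a); last by exists (fun=> 0).
  have /countable_injP[f finj] := cI a.
  have /choice[e eP] n : exists y, I a y /\ forall y', I a y' -> f y' = n -> y = y'.
    have [[y [Iy <-]]|ny] := EM (exists y, I a y /\ f y = n).
      by exists y; split=> // y' Iy' E; apply: finj; rewrite ?inE.
    by exists 0; split; [exact: subI.1 | move=> y' Iy' E; case: ny; exists y'].
  exists e => _; split=> [n|y Iy]; first exact: (eP n).1.
  by exists (f y); exact: (eP (f y)).2.
(* The last clause asks that all earlier witnesses lie below [a], which stacks the families as the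
   extension of linear maps requires. *)
pose B p := [set a | [/\ good a, wp a = p &
  forall a', slt le a' a -> I a (wx a') /\ forall x, x \in wxs a' -> I a x]].
pose br := branch wxs ws wu enum.
have br_inj p b b' : B p b -> B p b' -> (forall n, br b n = br b' n) -> b = b'.
  move=> [/enumP[be eb] _ _] [/enumP[b'e eb'] _ _] E.
  have EE n : enum b n = enum b' n by have := E n => -[].
  have [le_bb'|le_b'b] := wo_total wo b b'; apply: contrapT => nbb'.
    have /eb'[n nb] : I b' b by apply: slt_neq => //; exact/eqP.
    by have := be n; rewrite EE nb; apply: (slt_irr wo).
  have /eb[n nb] : I b b' by apply: slt_neq => //; apply/eqP/nesym.
  by have := b'e n; rewrite -EE nb; apply: (slt_irr wo).
(* The larger of the two module elements of a label. The scalars need no bound, since [R] is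
   countable. *)
pose top (d : label M) := if le d.1.1 d.1.2 then d.1.2 else d.1.1.
have top_countable x : countable [set d | le (top d) x].
  have cs : countable [set: seq R].
    by apply: sub_countable (countable_seq R_countable); apply: subset_card_le.
  apply: sub_countable (countableX (countableX (cM x) (cM x)) cs).
  apply: subset_card_le => -[[d1 d2] s] /=; rewrite /top /=; case: ifP => [dd d2x|dd d1x].
    by split=> //; split=> //; apply: wo_trans dd d2x.
  split=> //; split=> //; apply: (wo_trans wo) d1x.
  by have [|//] := wo_total wo d1 d2; rewrite dd.
have top_br p b n : B p b -> slt le (top (br b n)) b.
  move=> [gb _ _]; have [_ sb _ _] := wP b gb; rewrite /top /=.
  by case: ifP => _; [exact: (sb n.+1).1 | exact: ((enumP b gb).1 n)].
have subN p : submodule (span (ladder_gen p (B p) br)) by exact: span_submodule.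
(* A non-free ladder module for some prime is the required module; if all of them are free, [M] will
   turn out to be free. *)
have [[p [S [pp SE nfree]]]|allfree] := EM (exists p (S : submodClosed (seq (label M) -> R^o)),
    [/\ prime_element p, forall v, (v \in S) = `[< span (ladder_gen p (B p) br) v >] &
        ~ is_free (submod S)]).
  exists (submod S); split=> //.
    apply: (ladder_card R_countable wo unM cM top_countable SE (iota := fun m => (m, 0, [::]))).
    by move=> m m' [].
  apply: (ladder_whitehead pp (@br_inj p) _ SE) => c.
  have [q qp npq] := coprime_prime_ex R_two_primes pp.
  have fr := @frac_repr R.
  apply: (@uniformization R R_PID _ (@tofrac R) _ fr code code_inj M hsM le wo (B p) p wx wxs wz ws wu
    enum _ _ _ pp q qp npq c).
  - by move=> a b /eqP; rewrite tofrac_eq => /eqP.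
  - by move=> b [[]].
  - by move=> b b' [_ _ sb] _ /sb.
  - by move=> b [gb <- _]; exact: wP.
have /choice[Gp GpP] p : exists G : M -> M, prime_element p ->
    forall a, (forall y, slt le y a -> slt le (G y) a) -> ~ B p a.
  have [pp|] := EM (prime_element p); last by exists id.
  have [S SE] := submodClosed_of_set (subN p).
  have [|G GP] := @ladder_free_closed _ R_PID R_countable _ pp _ _ _ _ (@br_inj p) _ wo unM cM
    _ top_countable (@top_br p) S SE.
    by apply: contrapT => nf; apply: allfree; exists p, S.
  by exists G.
exfalso; apply: nfreeM.
(* Below a closed point this bound keeps pure closures, so [I a] is a pure submodule; the bounds
   [Gp] for all [p], so the freeness of each ladder module applies; and the witnesses, so the
   families are stacked. *)
have /choice[G GP] y : exists u, forall z, [\/ purecl [set y' | le y' y] z,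
    (exists p, z = Gp p y) | (z = wx y \/ z \in wxs y)] -> slt le z u.
  pose F (i : nat) := match i with
    | 0 => purecl [set y' | le y' y] | 1 => range (Gp^~ y) | _ => [set` wx y :: wxs y] end.
  have [|u uP] := @countable_bounded _ le (\bigcup_(i in [set: nat]) F i) unM cM.
    apply: bigcup_countable => // -[|[|i]] _ /=.
    - exact: purecl_countable.
    - exact: sub_countable (card_image_le _ _) R_countable.
    - exact/finite_set_countable/finite_seq.
  exists u => z [zy|[p ->]|zw]; apply: uP; first by exists 0%N.
    by exists 1%N => //; exists p.
  by exists 2%N => //=; rewrite inE; case: zw => [->|->]; rewrite ?eqxx ?orbT.
apply: (free_of_filtration R_PID R_fin_primes tf wo unM cM (G := G)) => a ca badI.
have Glt z y : slt le y a -> [\/ purecl [set y' | le y' y] z,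
    (exists p, z = Gp p y) | (z = wx y \/ z \in wxs y)] -> slt le z a.
  by move=> ya zP; apply: (slt_le_trans wo (GP y z zP)); exact: (sltW wo (ca y ya)).
(* At the least point [I a] is empty and not a submodule; its pure closures are those of the zero
   module. *)
have [[y0 y0a]|Ia0] := EM (exists y, I a y); last first.
  apply: (aleph1_free_mod0 R_PID R_fin_primes hsM).
  have [p [xs [x [pp nx xdiv]]]] := badI; exists p, xs, x.
  suff clE : purecl ([set 0] `|` [set` xs]) = purecl (I a `|` [set` xs]) by split; rewrite ?clE.
  apply/predeqP => m; split; apply: purecl_sub => z.
    by move=> [->|zxs]; [exact: (purecl_submodule _).1 | by apply: purecl_self; right].
  by move=> [za|zxs]; [case: Ia0; exists z | apply: purecl_self; right].
have Ipure z y : slt le y a -> purecl [set y' | le y' y] z -> I a z.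
  by move=> ya zy; apply: (Glt z y ya); constructor 1.
have ga : good a.
  split=> //.
    split; first by apply: (Ipure 0 y0 y0a); exact: (purecl_submodule _).1.
    move=> r x y xa ya; have [xy|yx] := wo_total wo x y.
      apply: (Ipure _ y) => //; apply: (purecl_submodule _).2; apply: purecl_self => //=.
      exact: wo_refl.
    apply: (Ipure _ x) => //; apply: (purecl_submodule _).2; apply: purecl_self => //=.
    exact: wo_refl.
  move=> r m r0 rma; apply: (Ipure _ (r *: m) rma).
  by apply: (purecl_pure r0); apply: purecl_self; exact: wo_refl.
have [pp _ _ _] := wP a ga.
apply: (GpP _ pp a).
  by move=> y ya; apply: (Glt _ y ya); constructor 2; exists (w a).1.1.
split=> // a' a'a; split=> [|x xw]; apply: (Glt _ a' a'a); constructor 3; first by left.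
by right.
Qed.
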